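(* Let $\alpha,\bar\alpha\in\mathbb{C}$ and $\Delta,\bar\Delta\in\mathbb{C}^*$. Consider extensions of conformal $\mathrm{SV}$-modules $$0\to V(\bar\alpha,\bar\Delta)\to E\to V(\alpha,\Delta)\to0,$$ realized as $E=\mathbb{C}[\partial]v_{\bar\Delta}\oplus\mathbb{C}[\partial]v_\Delta$ with $\mathbb{C}[\partial]v_{\bar\Delta}\cong V(\bar\alpha,\bar\Delta)$ a submodule and $$L_\lambda v_\Delta=(\partial+\alpha+\Delta\lambda)v_\Delta+f(\partial,\lambda)v_{\bar\Delta},\quad M_\lambda v_\Delta=g(\partial,\lambda)v_{\bar\Delta},\quad Y_\lambda v_\Delta=h(\partial,\lambda)v_{\bar\Delta},$$ with $f,g,h\in\mathbb{C}[\partial,\lambda]$. Nontrivial extensions of this form exist only if $\alpha=\bar\alpha$ and $\Delta-\bar\Delta\in\{0,2,3,4,5,6,\tfrac12,-\tfrac12,\tfrac32\}$. Writing $\bar\partial=\partial+\alpha$, the following is a complete list of values of $\Delta,\bar\Delta$ with triples $(f,g,h)$ whose nonzero scalar multiples give rise to the nontrivial extensions (up to equivalence): (i) $g=h=0$ and $f$ is one of the following (Virasoro case): $\Delta=\bar\Delta$, $f=c_0+c_1\lambda$ with $(c_0,c_1)\neq(0,0)$; $\Delta-\bar\Delta=2$, $f=\lambda^2(2\bar\partial+\lambda)$; $\Delta-\bar\Delta=3$, $f=\bar\partial\lambda^2(\bar\partial+\lambda)$; $\Delta-\bar\Delta=4$, $f=\lambda^2(4\bar\partial^3+6\bar\partial^2\lambda-\bar\partial\lambda^2+\bar\Delta\lambda^3)$;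 $(\Delta,\bar\Delta)=(1,-4)$, $f=\bar\partial^4\lambda^2-10\bar\partial^2\lambda^4-17\bar\partial\lambda^5-8\lambda^6$; $(\Delta,\bar\Delta)=(\tfrac72\pm\tfrac{\sqrt{19}}2,-\tfrac52\pm\tfrac{\sqrt{19}}2)$, $f=\bar\partial^4\lambda^3-(2\bar\Delta+3)\bar\partial^3\lambda^4-3\bar\Delta\bar\partial^2\lambda^5-(3\bar\Delta+1)\bar\partial\lambda^6-(\bar\Delta+\tfrac9{28})\lambda^7$; (ii) $\Delta-\bar\Delta=-\tfrac12$, $f=g=0$, $h=a_0$ with $a_0\in\mathbb{C}^*$; (iii) $\Delta-\bar\Delta=\tfrac12$, $f=g=0$, $h=a_0(\bar\partial+2\bar\Delta\lambda)$ with $a_0\in\mathbb{C}^*$; (iv) $(\Delta,\bar\Delta)=(1,-\tfrac12)$, $f=g=0$, $h=a_0(\bar\partial^2-\lambda^2)$ with $a_0\in\mathbb{C}^*$.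
   Context: A Lie conformal algebra is a $\mathbb{C}[\partial]$-module $R$ with a $\lambda$-bracket satisfying conformal sesquilinearity, skew-symmetry and the Jacobi identity; a conformal module over $R$ is a $\mathbb{C}[\partial]$-module $V$ with $a\mapsto a_\lambda\in\mathrm{End}_{\mathbb{C}}(V)\otimes\mathbb{C}[\lambda]$ satisfying $[a_\lambda,b_\mu]=[a_\lambda b]_{\lambda+\mu}$ and $(\partial a)_\lambda=[\partial,a_\lambda]=-\lambda a_\lambda$. $\mathrm{SV}$ is the free $\mathbb{C}[\partial]$-module with basis $L,M,Y$ and nonzero brackets $[L_\lambda L]=(\partial+2\lambda)L$, $[L_\lambda Y]=(\partial+\tfrac32\lambda)Y$, $[L_\lambda M]=(\partial+\lambda)M$, $[Y_\lambda Y]=(\partial+2\lambda)M$. $V(\alpha,\Delta)=\mathbb{C}[\partial]v_\Delta$ with $L_\lambda v_\Delta=(\partial+\alpha+\Delta\lambda)v_\Delta$, $M_\lambda v_\Delta=Y_\lambda v_\Delta=0$. An extension of $W$ by $V$ is an exact sequence $0\to V\to E\to W\to 0$ of conformal modules; equivalence is via a module map of middle terms compatible with identities on $V$ and $W$; trivial means equivalent to the direct sum. *)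

(* Defs.v *)
From HB Require Import structures.
From mathcomp Require Import all_boot all_order all_algebra.
From mathcomp Require Import mpoly.
Set Implicit Arguments. Unset Strict Implicit. Unset Printing Implicit Defensive.
Import Order.TTheory GRing.Theory Num.Theory.
Local Open Scope ring_scope.

(*   {mpoly C[2]} : polynomials in (∂, λ)        ('X_0 = ∂, 'X_1 = λ)        *)
(*   {mpoly C[3]} : polynomials in (∂, λ, μ)     ('X_0 = ∂, 'X_1 = λ, 'X_2 = μ)*)
(*   {mpoly C[1]} : polynomials in ∂ alone                                   *)
(*   E = C[∂] vbar ⊕ C[∂] v ;  an element of E[λ,μ] is a pair (p, q)         *)
(*   standing for p·vbar + q·v with p q ∈ C[∂,λ,μ].                           *)

Section Defs.
Variable C : numClosedFieldType.

Definition i30 : 'I_3 := @Ordinal 3 0 isT.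
Definition i31 : 'I_3 := @Ordinal 3 1 isT.
Definition i32 : 'I_3 := @Ordinal 3 2 isT.
Definition i20 : 'I_2 := @Ordinal 2 0 isT.
Definition i21 : 'I_2 := @Ordinal 2 1 isT.

Definition Dv : {mpoly C[3]} := 'X_i30.
Definition Lv : {mpoly C[3]} := 'X_i31.
Definition Mv : {mpoly C[3]} := 'X_i32.
Definition D2 : {mpoly C[2]} := 'X_i20.
Definition L2 : {mpoly C[2]} := 'X_i21.

Definition emb1 (p : {mpoly C[1]}) : {mpoly C[3]} := p \mPo [tuple Dv].
Definition inst (r : {mpoly C[2]}) (t : {mpoly C[3]}) : {mpoly C[3]} :=
  r \mPo [tuple Dv; t].
Definition shift (t : {mpoly C[3]}) (p : {mpoly C[3]}) : {mpoly C[3]} :=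
  p \mPo [tuple Dv + t; Lv; Mv].

(* The basis L, M, Y of SV as a free C[∂]-module. *)
Inductive SVgen := GL | GM | GY.

(* The λ-bracket of SV on basis elements: [a_λ b] = Σ_c (svbr a b c)(∂,λ) c.
   The listed brackets, and those obtained from them by skew-symmetry
   [b_λ a] = -[a_{-λ-∂} b]; all others vanish. *)
Definition svbr (a b c : SVgen) : {mpoly C[2]} :=
  match a, b, c with
  | GL, GL, GL => D2 + 2%:R *: L2
  | GL, GY, GY => D2 + (3%:R / 2%:R) *: L2
  | GY, GL, GY => (1 / 2%:R) *: D2 + (3%:R / 2%:R) *: L2
  | GL, GM, GM => D2 + L2
  | GM, GL, GM => L2
  | GY, GY, GM => D2 + 2%:R *: L2
  | _, _, _ => 0
  end.

(* x_λ vbar = rhobar x (∂,λ) vbar *)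
Definition rhobar (abar Dbar : C) (x : SVgen) : {mpoly C[2]} :=
  match x with GL => D2 + abar%:MP + Dbar *: L2 | _ => 0 end.
(* x_λ v = rho x (∂,λ) v + phi x (∂,λ) vbar *)
Definition rho (a D : C) (x : SVgen) : {mpoly C[2]} :=
  match x with GL => D2 + a%:MP + D *: L2 | _ => 0 end.
Definition phi (f g h : {mpoly C[2]}) (x : SVgen) : {mpoly C[2]} :=
  match x with GL => f | GM => g | GY => h end.

(* The operator x_t on E[λ,μ] (C[λ,μ]-linear, with x_t (p(∂) w) = p(∂+t) x_t w),
   where t is the spectral parameter (λ, μ or λ+μ). *)
Definition act (a D abar Dbar : C) (f g h : {mpoly C[2]}) (x : SVgen)
  (t : {mpoly C[3]}) (w : {mpoly C[3]} * {mpoly C[3]}) :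
  {mpoly C[3]} * {mpoly C[3]} :=
  (shift t w.1 * inst (rhobar abar Dbar x) t + shift t w.2 * inst (phi f g h x) t,
   shift t w.2 * inst (rho a D x) t).

Definition paddE (w1 w2 : {mpoly C[3]} * {mpoly C[3]}) := (w1.1 + w2.1, w1.2 + w2.2).
Definition psubE (w1 w2 : {mpoly C[3]} * {mpoly C[3]}) := (w1.1 - w2.1, w1.2 - w2.2).
Definition pscaleE (s : {mpoly C[3]}) (w : {mpoly C[3]} * {mpoly C[3]}) :=
  (s * w.1, s * w.2).

(* [a_λ b]_{λ+μ} acting on w: Σ_c P_c(-(λ+μ), λ) c_{λ+μ} w,
   where [a_λ b] = Σ_c P_c(∂,λ) c. *)
Definition bract (a D abar Dbar : C) (f g h : {mpoly C[2]}) (x y : SVgen)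
  (w : {mpoly C[3]} * {mpoly C[3]}) :=
  let coef c := svbr x y c \mPo [tuple - (Lv + Mv); Lv] in
  let T := Lv + Mv in
  paddE (pscaleE (coef GL) (act a D abar Dbar f g h GL T w))
   (paddE (pscaleE (coef GM) (act a D abar Dbar f g h GM T w))
          (pscaleE (coef GY) (act a D abar Dbar f g h GY T w))).

(* E is a conformal SV-module: [x_λ, y_μ] = [x_λ y]_{λ+μ} on E, for all basis
   elements x, y (the remaining axioms (∂a)_λ = -λ a_λ, [∂, a_λ] = -λ a_λ hold
   by construction of act). *)
Definition is_conf_module (a D abar Dbar : C) (f g h : {mpoly C[2]}) : Prop :=
  forall (x y : SVgen) (p q : {mpoly C[1]}),
    let w := (emb1 p, emb1 q) in
    let A := act a D abar Dbar f g h in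
    psubE (A x Lv (A y Mv w)) (A y Mv (A x Lv w))
    = bract a D abar Dbar f g h x y w.

(* Equivalence of two extensions of this form (same α, Δ, αbar, Δbar):
   a C[∂]-module map φ : E → E' with φ(vbar) = vbar' (identity on V(αbar,Δbar))
   and inducing the identity on V(α,Δ), i.e. φ(v) = v' + r(∂) vbar', which
   intertwines the λ-actions of L, M, Y. *)
Definition phimap (r : {mpoly C[1]}) (w : {mpoly C[3]} * {mpoly C[3]}) :=
  (w.1 + emb1 r * w.2, w.2).

Definition ext_equiv (a D abar Dbar : C) (f g h f' g' h' : {mpoly C[2]}) : Prop :=
  exists r : {mpoly C[1]},
    forall (x : SVgen) (p q : {mpoly C[1]}),
      let w := (emb1 p, emb1 q) in
      phimap r (act a D abar Dbar f g h x Lv w)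
      = act a D abar Dbar f' g' h' x Lv (phimap r w).

Definition ext_trivial (a D abar Dbar : C) (f g h : {mpoly C[2]}) : Prop :=
  ext_equiv a D abar Dbar f g h 0 0 0.

Definition listed (a D Dbar : C) (f g h : {mpoly C[2]}) : Prop :=
  let Dbv := D2 + a%:MP in
  let l := L2 in
  let k (c : C) : {mpoly C[2]} := c%:MP in
  (g = 0 /\ h = 0 /\
   ( (D = Dbar /\ exists c0 c1 : C, (c0, c1) != (0, 0) /\ f = k c0 + k c1 * l)
   \/ (D - Dbar = 2%:R /\ f = l ^+ 2 * (2%:R *: Dbv + l))
   \/ (D - Dbar = 3%:R /\ f = Dbv * l ^+ 2 * (Dbv + l))
   \/ (D - Dbar = 4%:R /\
       f = l ^+ 2 * (4%:R *: Dbv ^+ 3 + 6%:R *: (Dbv ^+ 2 * l) - Dbv * l ^+ 2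
                     + Dbar *: l ^+ 3))
   \/ (D = 1 /\ Dbar = - 4%:R /\
       f = Dbv ^+ 4 * l ^+ 2 - 10%:R *: (Dbv ^+ 2 * l ^+ 4)
           - 17%:R *: (Dbv * l ^+ 5) - 8%:R *: l ^+ 6)
   \/ (exists s : C, (s = 1 \/ s = -1) /\
       D = 7%:R / 2%:R + s * sqrtC 19%:R / 2%:R /\
       Dbar = - (5%:R / 2%:R) + s * sqrtC 19%:R / 2%:R /\
       f = Dbv ^+ 4 * l ^+ 3 - (2%:R * Dbar + 3%:R) *: (Dbv ^+ 3 * l ^+ 4)
           - (3%:R * Dbar) *: (Dbv ^+ 2 * l ^+ 5)
           - (3%:R * Dbar + 1) *: (Dbv * l ^+ 6)
           - (Dbar + 9%:R / 28%:R) *: l ^+ 7)))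
  \/ (D - Dbar = - (1 / 2%:R) /\ f = 0 /\ g = 0 /\
      exists a0 : C, a0 != 0 /\ h = k a0)
  \/ (D - Dbar = 1 / 2%:R /\ f = 0 /\ g = 0 /\
      exists a0 : C, a0 != 0 /\ h = a0 *: (Dbv + (2%:R * Dbar) *: l))
  \/ (D = 1 /\ Dbar = - (1 / 2%:R) /\ f = 0 /\ g = 0 /\
      exists a0 : C, a0 != 0 /\ h = a0 *: (Dbv ^+ 2 - l ^+ 2)).

Definition allowed_shifts : seq C :=
  [:: 0; 2%:R; 3%:R; 4%:R; 5%:R; 6%:R; 1 / 2%:R; - (1 / 2%:R); 3%:R / 2%:R].

End Defs.

(* Main.v *)
(* On [E] the relation [Y_λ Y_μ] forces g = 0, and the remaining conditions on f
   and h decouple into two linear functional equations. The action of L_0 shows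
   that f is a coboundary and h = 0 when α <> αbar; otherwise translating ∂
   reduces to α = 0, where the equations compare coefficients of ∂^k λ^i μ^j.
   Modulo coboundaries f is then homogeneous of degree n = Δ - Δbar + 1 (up to a
   constant when Δ = Δbar), and for n >= 2 it is determined by the coefficients
   a2, a3 of λ^2, λ^3. Hence f is a coboundary as soon as (a2, a3) is proportional
   to the corresponding pair (t2, t3) of the coboundary of ∂^(n-1), that is when
   the determinant a2 t3 - a3 t2 vanishes. Computing the coefficient of λ^6 in two
   ways gives, for n >= 6, that this determinant is zero unless
   (n-1)(n-6) + 4 Δbar (n-2) + 4 Δbar^2 = 0; for n >= 8 the coefficient of λ^8
   rules out the exceptions. Likewise h is homogeneous of degree Δ - Δbar + 1/2
   and determined by its coefficient of λ^0. *)
Require Import Defs.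
From HB Require Import structures.
From mathcomp Require Import all_boot all_order all_algebra.
From mathcomp Require Import mpoly ring zify.
Set Implicit Arguments. Unset Strict Implicit. Unset Printing Implicit Defensive.
Import Order.TTheory GRing.Theory Num.Theory.
Local Open Scope ring_scope.

(** * Substitution into polynomials and coefficients of the result *)

Notation mon2 i j := [multinom [tuple i%N; j%N]].
Notation mon3 k i j := [multinom [tuple k%N; i%N; j%N]].

Lemma comp_mpolyA (R : comNzRingType) n k l (p : {mpoly R[n]})
    (lq : n.-tuple {mpoly R[k]}) (lr : k.-tuple {mpoly R[l]}) :
  (p \mPo lq) \mPo lr = p \mPo [tuple tnth lq i \mPo lr | i < n].
Proof.
rewrite [p \mPo lq]comp_mpolyEX [RHS]comp_mpolyEX raddf_sum.
apply: eq_bigr => m _; rewrite /= comp_mpolyZ; congr (_ *: _).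
rewrite !comp_mpolyX rmorph_prod; apply: eq_bigr => i _.
by rewrite /= rmorphXn tnth_mktuple.
Qed.

Section Substitution.
Variable R : comNzRingType.

Lemma comp_mpolyA1 k l (p : {mpoly R[1]}) (x : {mpoly R[k]})
    (lr : k.-tuple {mpoly R[l]}) :
  (p \mPo [tuple x]) \mPo lr = p \mPo [tuple x \mPo lr].
Proof.
rewrite comp_mpolyA; congr (_ \mPo _); apply/val_inj.
by rewrite /= !enum_ordSl enum_ord0.
Qed.

Lemma comp_mpolyA2 k l (p : {mpoly R[2]}) (x y : {mpoly R[k]})
    (lr : k.-tuple {mpoly R[l]}) :
  (p \mPo [tuple x; y]) \mPo lr = p \mPo [tuple x \mPo lr; y \mPo lr].
Proof.
rewrite comp_mpolyA; congr (_ \mPo _); apply/val_inj.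
by rewrite /= !enum_ordSl enum_ord0 /= !(tnth_nth 0).
Qed.

Lemma comp_mpoly2E k (p : {mpoly R[2]}) (x y : {mpoly R[k]}) :
  p \mPo [tuple x; y] =
  \sum_(m <- msupp p) p@_m *: (x ^+ m ord0 * y ^+ m (lift ord0 ord0)).
Proof.
rewrite comp_mpolyE; apply: eq_bigr => m _; congr (_ *: _).
by rewrite big_ord_recl big_ord1 !(tnth_nth 0).
Qed.

Lemma comp_mpoly1E k (p : {mpoly R[1]}) (x : {mpoly R[k]}) :
  p \mPo [tuple x] = \sum_(m <- msupp p) p@_m *: (x ^+ m ord0).
Proof.
rewrite comp_mpolyE; apply: eq_bigr => m _; congr (_ *: _).
by rewrite big_ord1 (tnth_nth 0).
Qed.

Lemma mon2P (m : 'X_{1..2}) i j :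
  (m == mon2 i j) = (m ord0 == i) && (m (lift ord0 ord0) == j).
Proof.
apply/eqP/andP => [-> | [/eqP <- /eqP <-]]; first by split.
by apply/mnmP => u; case: (unliftP ord0 u) => [v|] -> //; rewrite ord1.
Qed.

(** In every substitution used below, such as ∂ + λ for ∂, a given monomial of the result comes from
    a single monomial of [p]; the weight [w] is then a binomial coefficient or an indicator. *)
Lemma mcoeff_comp2 k (p : {mpoly R[2]}) (x y : {mpoly R[k]}) M w a b :
  (forall u v, (x ^+ u * y ^+ v)@_M = w * ((u == a) && (v == b))%:R) ->
  (p \mPo [tuple x; y])@_M = p@_(mon2 a b) * w.
Proof.
move=> Hm; rewrite comp_mpoly2E raddf_sum /= [in RHS](mpolyE p) raddf_sum /=.
rewrite mulr_suml; apply: eq_bigr => m _.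
by rewrite !mcoeffZ Hm mcoeffX mon2P -!mulrA [w * _]mulrC.
Qed.

Lemma mcoeff_comp1 k (p : {mpoly R[1]}) (x : {mpoly R[k]}) M w a :
  (forall u, (x ^+ u)@_M = w * (u == a)%:R) ->
  (p \mPo [tuple x])@_M = p@_[multinom [tuple a]] * w.
Proof.
move=> Hm; rewrite comp_mpoly1E raddf_sum /= [in RHS](mpolyE p) raddf_sum /=.
rewrite mulr_suml; apply: eq_bigr => m _.
rewrite !mcoeffZ Hm mcoeffX -!mulrA [w * _]mulrC; congr (_ * ((nat_of_bool _)%:R * _)).
apply/eqP/eqP => [<-|->]; last by [].
by apply/mnmP => u; rewrite ord1.
Qed.

Lemma mcoeffXl k i (p : {mpoly R[k]}) (M M' : 'X_{1..k}) :
  M = (U_(i) + M')%MM -> ('X_i * p)@_M = p@_M'.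
Proof. by move=> ->; rewrite mulrC mcoeffMX. Qed.

Lemma mcoeffXl0 k i (p : {mpoly R[k]}) (M : 'X_{1..k}) :
  M i = 0%N -> ('X_i * p)@_M = 0.
Proof.
move=> M0; rewrite (mpolyE p) mulr_sumr raddf_sum big1 //= => m _.
rewrite -scalerAr mcoeffZ -mpolyXD mcoeffX; case: eqP => [E|_]; last by rewrite mulr0.
by move: M0; rewrite -E mnmDE mnmE eqxx.
Qed.

End Substitution.

Section Extensions.
Variable C : numClosedFieldType.
Notation Dv := (Dv C).
Notation Lv := (Lv C).
Notation Mv := (Mv C).
Notation D2 := (D2 C).
Notation L2 := (L2 C).
Implicit Types (a abar D Db : C) (f g h : {mpoly C[2]}) (r : {mpoly C[1]}).

(** * Coefficients in C[∂, λ] and C[∂, λ, μ] *)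

Lemma mcoeff_mon3 u v w k i j :
  (Dv ^+ u * Lv ^+ v * Mv ^+ w)@_(mon3 k i j) =
  [&& u == k, v == i & w == j]%:R.
Proof.
have -> : Dv ^+ u * Lv ^+ v * Mv ^+ w = 'X_[mon3 u v w].
  by rewrite mpolyXE_id 2!big_ord_recl big_ord1 mulrA;
     congr ('X_ _ ^+ _ * 'X_ _ ^+ _ * 'X_ _ ^+ _); apply/val_inj.
rewrite mcoeffX; congr (_ %:R); congr nat_of_bool.
apply/eqP/and3P => [E|[/eqP-> /eqP-> /eqP->]] //.
by split; apply/eqP; [have := congr1 (fun m : 'X_{1..3} => m i30) E |
  have := congr1 (fun m : 'X_{1..3} => m i31) E |
  have := congr1 (fun m : 'X_{1..3} => m i32) E].
Qed.

Lemma mcoeff_mon2 u v k i :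
  (D2 ^+ u * L2 ^+ v)@_(mon2 k i) = ((u == k) && (v == i))%:R.
Proof.
have -> : D2 ^+ u * L2 ^+ v = 'X_[mon2 u v].
  by rewrite mpolyXE_id big_ord_recl big_ord1;
     congr ('X_ _ ^+ _ * 'X_ _ ^+ _); apply/val_inj.
by rewrite mcoeffX mon2P.
Qed.

Lemma mcoeff_Dv p k i j :
  (Dv * p)@_(mon3 k i j) = if k is k'.+1 then p@_(mon3 k' i j) else 0.
Proof.
case: k => [|k]; first by apply: mcoeffXl0.
apply: mcoeffXl; apply/mnmP => u; rewrite mnmDE mnm1E.
by case: (unliftP ord0 u) => [{}u|] -> //; case: (unliftP ord0 u) => [{}u|] -> //; rewrite ord1.
Qed.

Lemma mcoeff_Lv p k i j :
  (Lv * p)@_(mon3 k i j) = if i is i'.+1 then p@_(mon3 k i' j) else 0.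
Proof.
case: i => [|i]; first by apply: mcoeffXl0.
apply: mcoeffXl; apply/mnmP => u; rewrite mnmDE mnm1E.
by case: (unliftP ord0 u) => [{}u|] -> //; case: (unliftP ord0 u) => [{}u|] -> //; rewrite ord1.
Qed.

Lemma mcoeff_Mv p k i j :
  (Mv * p)@_(mon3 k i j) = if j is j'.+1 then p@_(mon3 k i j') else 0.
Proof.
case: j => [|j]; first by apply: mcoeffXl0.
apply: mcoeffXl; apply/mnmP => u; rewrite mnmDE mnm1E.
by case: (unliftP ord0 u) => [{}u|] -> //; case: (unliftP ord0 u) => [{}u|] -> //; rewrite ord1.
Qed.

Lemma mcoeff_D2 p k i :
  (D2 * p)@_(mon2 k i) = if k is k'.+1 then p@_(mon2 k' i) else 0.
Proof.
case: k => [|k]; first by apply: mcoeffXl0.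
apply: mcoeffXl; apply/mnmP => u; rewrite mnmDE mnm1E.
by case: (unliftP ord0 u) => [{}u|] -> //; rewrite ord1.
Qed.

Lemma mcoeff_L2 p k i :
  (L2 * p)@_(mon2 k i) = if i is i'.+1 then p@_(mon2 k i') else 0.
Proof.
case: i => [|i]; first by apply: mcoeffXl0.
apply: mcoeffXl; apply/mnmP => u; rewrite mnmDE mnm1E.
by case: (unliftP ord0 u) => [{}u|] -> //; rewrite ord1.
Qed.

(** Reads off ∂^k λ^i in the binomial expansion of (∂ + λ)^a: only the term s = i can contribute. *)
Lemma sum_bin_delta (a k i : nat) :
  \sum_(s < a.+1) ((a - s == k)%N && (s == i :> nat))%:R *+ 'C(a, s) =
  'C(k + i, i)%:R * (a == k + i)%N%:R :> C.
Proof.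
have [-> | ne] := eqVneq a (k + i)%N.
  have lt_i : (i < (k + i).+1)%N by rewrite ltnS leq_addl.
  rewrite (bigD1 (Ordinal lt_i)) //= addnK !eqxx mulr1 big1 ?addr0 //.
  by move=> s /negPf ne; rewrite -val_eqE /= in ne; rewrite ne andbF mul0rn.
rewrite mulr0 big1 // => s _; case: andP => [[/eqP E /eqP F]|]; last by rewrite mul0rn.
by case/eqP: ne; rewrite -E -F subnK // -ltnS.
Qed.

(** * The cocycle equations and the rules for substitution *)

(** Named forms of substitution, which rewriting and [gen_atoms] recognise by their head. *)
Definition ev k f (x y : {mpoly C[k]}) : {mpoly C[k]} := f \mPo [tuple x; y].
Definition ev1 k r (x : {mpoly C[k]}) : {mpoly C[k]} := r \mPo [tuple x].

(* The coefficient of [vbar] in [L_λ, L_μ] v = (λ - μ) L_(λ+μ) v. *)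
Definition LL_cocycle a D abar Db f : Prop :=
  (Dv + Lv + a%:MP + D *: Mv) * ev f Dv Lv
  + (Dv + abar%:MP + Db *: Lv) * ev f (Dv + Lv) Mv
  - ((Dv + Mv + a%:MP + D *: Lv) * ev f Dv Mv
     + (Dv + abar%:MP + Db *: Mv) * ev f (Dv + Mv) Lv)
  = (Lv - Mv) * ev f Dv (Lv + Mv).

(* The coefficient of [vbar] in [L_λ, Y_μ] v = (λ/2 - μ) Y_(λ+μ) v. *)
Definition LY_cocycle a D abar Db h : Prop :=
  (Dv + abar%:MP + Db *: Lv) * ev h (Dv + Lv) Mv
  - (Dv + Mv + a%:MP + D *: Lv) * ev h Dv Mv
  = ((1 / 2%:R) *: Lv - Mv) * ev h Dv (Lv + Mv).

(* The change of [f] under [v ↦ v + r(∂) vbar], cf. [ext_equivP]. *)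
Definition coboundary a D abar Db r : {mpoly C[2]} :=
  (D2 + a%:MP + D *: L2) * ev1 r D2
  - (D2 + abar%:MP + Db *: L2) * ev1 r (D2 + L2).

Section Composition.
Variables (n k l : nat) (t : n.-tuple {mpoly C[k]}).

Lemma compM (p q : {mpoly C[n]}) : (p * q) \mPo t = (p \mPo t) * (q \mPo t).
Proof. exact: rmorphM. Qed.
Lemma compD (p q : {mpoly C[n]}) : (p + q) \mPo t = (p \mPo t) + (q \mPo t).
Proof. exact: rmorphD. Qed.
Lemma compN (p : {mpoly C[n]}) : (- p) \mPo t = - (p \mPo t).
Proof. exact: rmorphN. Qed.
Lemma compX (p : {mpoly C[n]}) m : (p ^+ m) \mPo t = (p \mPo t) ^+ m.
Proof. exact: rmorphXn. Qed.
Lemma compZ c (p : {mpoly C[n]}) : (c *: p) \mPo t = c *: (p \mPo t).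
Proof. exact: comp_mpolyZ. Qed.
Lemma compC c : (c%:MP : {mpoly C[n]}) \mPo t = c%:MP.
Proof. exact: comp_mpolyC. Qed.
Lemma comp0 : (0 : {mpoly C[n]}) \mPo t = 0. Proof. exact: comp_mpoly0. Qed.
Lemma comp1 : (1 : {mpoly C[n]}) \mPo t = 1. Proof. exact: comp_mpoly1. Qed.
Lemma comp_ev1 r x : ev1 r x \mPo t = ev1 r (x \mPo t).
Proof. exact: comp_mpolyA1. Qed.
Lemma comp_ev f x y : ev f x y \mPo t = ev f (x \mPo t) (y \mPo t).
Proof. exact: comp_mpolyA2. Qed.
Lemma scalerC c (p : {mpoly C[k]}) : c *: p = c%:MP * p.
Proof. by rewrite mul_mpolyC. Qed.
End Composition.

Section Evaluation.
Variables (k : nat) (x y : {mpoly C[k]}).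
Lemma evM f g : ev (f * g) x y = ev f x y * ev g x y. Proof. exact: compM. Qed.
Lemma evD f g : ev (f + g) x y = ev f x y + ev g x y. Proof. exact: compD. Qed.
Lemma evN f : ev (- f) x y = - ev f x y. Proof. exact: compN. Qed.
Lemma evX f m : ev (f ^+ m) x y = ev f x y ^+ m. Proof. exact: compX. Qed.
Lemma evZ c f : ev (c *: f) x y = c *: ev f x y. Proof. exact: compZ. Qed.
Lemma evC c : ev c%:MP x y = c%:MP. Proof. exact: compC. Qed.
Lemma ev0 : ev 0 x y = 0. Proof. exact: comp0. Qed.
Lemma ev_D2 : ev D2 x y = x. Proof. by rewrite /ev comp_mpolyXU. Qed.
Lemma ev_L2 : ev L2 x y = y. Proof. by rewrite /ev comp_mpolyXU. Qed.
Lemma ev_ev f g h : ev (ev f g h) x y = ev f (ev g x y) (ev h x y).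
Proof. exact: comp_ev. Qed.
Lemma ev_ev1 r g : ev (ev1 r g) x y = ev1 r (ev g x y).
Proof. exact: comp_ev1. Qed.
End Evaluation.

Lemma ev1_0 k (x : {mpoly C[k]}) : ev1 0 x = 0. Proof. exact: comp0. Qed.
Lemma ev1_1 k (x : {mpoly C[k]}) : ev1 1 x = 1. Proof. exact: comp1. Qed.

Section Coordinates.
Variable k : nat.
Implicit Types x y z : {mpoly C[k]}.
Lemma comp_Dv x y z : Dv \mPo [tuple x; y; z] = x.
Proof. by rewrite comp_mpolyXU. Qed.
Lemma comp_Lv x y z : Lv \mPo [tuple x; y; z] = y.
Proof. by rewrite comp_mpolyXU. Qed.
Lemma comp_Mv x y z : Mv \mPo [tuple x; y; z] = z.
Proof. by rewrite comp_mpolyXU. Qed.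
Lemma comp_D2 x y : D2 \mPo [tuple x; y] = x.
Proof. by rewrite comp_mpolyXU. Qed.
Lemma comp_L2 x y : L2 \mPo [tuple x; y] = y.
Proof. by rewrite comp_mpolyXU. Qed.
Lemma mpolyC_nat m : (m%:R : C)%:MP = m%:R :> {mpoly C[k]}.
Proof. exact: (rmorph_nat (@mpolyC k C)). Qed.
Lemma three_halves :
  (3%:R / 2%:R : C)%:MP = 1 + (1 / 2%:R : C)%:MP :> {mpoly C[k]}.
Proof. by rewrite -mpolyC1 -mpolyCD; congr mpolyC; field. Qed.
End Coordinates.

Lemma ev_id f : ev f D2 L2 = f.
Proof.
rewrite -[RHS]comp_mpoly_id; congr (_ \mPo _); apply/val_inj.
by rewrite /= !enum_ordSl enum_ord0 /=; congr [:: 'X_ _; 'X_ _]; apply/val_inj.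
Qed.

Lemma instE f t : inst f t = ev f Dv t. Proof. by []. Qed.
Lemma emb1E r : emb1 r = ev1 r Dv. Proof. by []. Qed.

(* [autorewrite] matches syntactically; ssreflect's rewriting would compare
   polynomials up to conversion, which is slow. *)
#[local] Hint Rewrite instE emb1E compD compN compM compX compZ compC comp0 comp1
  comp_ev1 comp_ev comp_Dv comp_Lv comp_Mv comp_D2 comp_L2
  evM evD evN evX evZ evC ev0 ev_D2 ev_L2 ev_ev ev_ev1 ev1_0 ev1_1 : comp.
#[local] Hint Rewrite scalerC three_halves mpolyC_nat : scal.

(* Turning every compound polynomial into a variable keeps [ring] from
   comparing them up to conversion. *)
Ltac gen_atoms :=
  repeat match goal with
  | |- context [ev ?f ?x ?y] => generalize (ev f x y); intro
  | |- context [ev1 ?f ?x] => generalize (ev1 f x); intro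
  | |- context [@mpolyC ?n ?R ?c] =>
      let x := fresh "k" in set x := (@mpolyC n R c); clearbody x
  end;
  repeat match goal with
  | |- context [Defs.Dv ?R] => generalize (Defs.Dv R); intro
  | |- context [Defs.Lv ?R] => generalize (Defs.Lv R); intro
  | |- context [Defs.Mv ?R] => generalize (Defs.Mv R); intro
  | |- context [Defs.D2 ?R] => generalize (Defs.D2 R); intro
  | |- context [Defs.L2 ?R] => generalize (Defs.L2 R); intro
  end.
Ltac scale_to_mul := autorewrite with scal;
  repeat match goal with
  | |- context [@GRing.scale ?R ?V ?c ?p] =>
      match type of (scalerC c p) with _ = ?r =>
        replace (@GRing.scale R V c p) with r by (symmetry; exact (scalerC c p))
      end
  end; autorewrite with scal.
Ltac mpoly_ring := scale_to_mul; gen_atoms; ring.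

(** * Extensions as cocycles modulo coboundaries *)

Lemma eq_sub_eq (V : zmodType) (x y x' y' : V) :
  x = y -> x' - y' = x - y -> x' = y'.
Proof. by move=> ->; rewrite subrr => /subr0_eq. Qed.

(** Here [c] is the cofactor by which a known equation is multiplied to yield the goal; the
    remaining identity is left to [ring] or [field]. *)
Lemma eq_sub_mul (R : pzRingType) (c x y x' y' : R) :
  x = y -> x' - y' = c * (x - y) -> x' = y'.
Proof. by move=> ->; rewrite subrr mulr0 => /subr0_eq. Qed.
Arguments eq_sub_mul {R} c {x y x' y'}.

(** Exchanging λ and μ gives, up to sign, the relation for the pair (Y, L). *)
Lemma LY_cocycle_swap a D abar Db h : LY_cocycle a D abar Db h ->
  (Dv + abar%:MP + Db *: Mv) * ev h (Dv + Mv) Lv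
  - (Dv + Lv + a%:MP + D *: Mv) * ev h Dv Lv
  = ((1 / 2%:R) *: Mv - Lv) * ev h Dv (Lv + Mv).
Proof.
move/(congr1 (fun P => P \mPo [tuple Dv; Mv; Lv])).
by autorewrite with comp; rewrite [Mv + Lv]addrC.
Qed.

(** Only the pairs (L, L), (Y, Y) and (L, Y) matter: once g = 0, the others hold identically or
    follow by exchanging λ and μ. *)
Lemma conf_moduleP a D abar Db f g h :
  is_conf_module a D abar Db f g h <->
  [/\ LL_cocycle a D abar Db f, g = 0 & LY_cocycle a D abar Db h].
Proof.
split.
  move=> H; split.
  (* The choice p = 0, q = 1 is the vector v itself. *)
  - have := congr1 fst (H GL GL 0 1).
    rewrite /psubE /bract /act /paddE /pscaleE /emb1 /shift /=.
    autorewrite with comp => E; apply: (eq_sub_eq E).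
    mpoly_ring.
  - have := congr1 fst (H GY GY 0 1).
    rewrite /psubE /bract /act /paddE /pscaleE /emb1 /shift /=.
    autorewrite with comp => E.
    (* Y annihilates vbar, so the commutator of Y_λ and Y_μ vanishes on v and only the bracket (λ -
       μ) M remains. *)
    have {}E : (Lv - Mv) * ev g Dv (Lv + Mv) = 0.
      by apply: (eq_sub_eq (esym E)); mpoly_ring.
    (* At λ = 0, with μ renamed to λ, this reads -λ g(∂, λ) = 0. *)
    have := congr1 (fun P => P \mPo [tuple D2; 0; L2]) E.
    autorewrite with comp; rewrite !add0r ev_id => /eqP; rewrite mulf_eq0 oppr_eq0.
    have /negPf-> : L2 != 0.
      apply/eqP => /(congr1 (fun P => P@_U_(i21))).
      by rewrite mcoeffXU eqxx mcoeff0 => /eqP; rewrite oner_eq0.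
    by rewrite orFb => /eqP.
  - have := congr1 fst (H GL GY 0 1).
    rewrite /psubE /bract /act /paddE /pscaleE /emb1 /shift /=.
    by autorewrite with comp => E; apply: (eq_sub_eq E); mpoly_ring.
case=> HL -> HY x y p q; have HY' := LY_cocycle_swap HY.
rewrite /psubE /bract /act /paddE /pscaleE /shift.
case: x; case: y => /=; congr pair; autorewrite with comp.
all: try mpoly_ring.
(* The vbar part of the defect on p vbar + q v is q(∂ + λ + μ) times the defect on v, since on vbar
   the relations are identities. *)
all: set s := ev1 q (Dv + Lv + Mv).
all: try have -> : ev1 p (Dv + (Lv + Mv)) = ev1 p (Dv + Lv + Mv) by rewrite addrA.
all: try have -> : ev1 p (Dv + Mv + Lv) = ev1 p (Dv + Lv + Mv) by rewrite addrAC.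
all: have -> : ev1 q (Dv + (Lv + Mv)) = s by rewrite addrA.
all: have -> : ev1 q (Dv + Mv + Lv) = s by rewrite addrAC.
rewrite /LL_cocycle in HL; rewrite /LY_cocycle in HY.
- apply: (eq_sub_mul s HL); mpoly_ring.
- mpoly_ring.
- apply: (eq_sub_mul s HY); mpoly_ring.
- apply: (eq_sub_mul (- s) HY'); mpoly_ring.
Qed.

(** M and Y act by zero on both ends, so changing v by a multiple of vbar affects f alone. *)
Lemma ext_equivP a D abar Db f g h f' g' h' :
  ext_equiv a D abar Db f g h f' g' h' <->
  exists r, [/\ f' = f + coboundary a D abar Db r, g' = g & h' = h].
Proof.
have inj f1 f2 : ev f1 Dv Lv = ev f2 Dv Lv -> f1 = f2.
  move/(congr1 (fun P => P \mPo [tuple D2; L2; 0])).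
  by autorewrite with comp; rewrite !ev_id.
split=> [[r H] | [r [-> -> ->]]].
  exists r; split; apply: inj.
  - have := congr1 fst (H GL 0 1).
    rewrite /phimap /act /shift /coboundary /=; autorewrite with comp => E.
    by apply: (eq_sub_eq (esym E)); mpoly_ring.
  - have := congr1 fst (H GM 0 1).
    rewrite /phimap /act /shift /=; autorewrite with comp => E.
    by apply: (eq_sub_eq (esym E)); mpoly_ring.
  - have := congr1 fst (H GY 0 1).
    rewrite /phimap /act /shift /=; autorewrite with comp => E.
    by apply: (eq_sub_eq (esym E)); mpoly_ring.
exists r => x p q; rewrite /phimap /act /shift /coboundary /=.
by case: x; congr pair; rewrite /=; autorewrite with comp; mpoly_ring.
Qed.

(** A coboundary is the f of the direct sum, read in the basis vbar, v - r(∂) vbar. *)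
Lemma LL_cocycle_coboundary a D abar Db r :
  LL_cocycle a D abar Db (coboundary a D abar Db r).
Proof.
rewrite /LL_cocycle /coboundary; autorewrite with comp.
set s := ev1 r (Dv + Lv + Mv).
have -> : ev1 r (Dv + (Lv + Mv)) = s by rewrite addrA.
have -> : ev1 r (Dv + Mv + Lv) = s by rewrite addrAC.
by mpoly_ring.
Qed.

Lemma LL_cocycleD a D abar Db f f' : LL_cocycle a D abar Db f ->
  LL_cocycle a D abar Db f' -> LL_cocycle a D abar Db (f + f').
Proof.
rewrite /LL_cocycle => H H'; autorewrite with comp; rewrite [RHS]mulrDr -H -H'.
by mpoly_ring.
Qed.

Lemma LL_cocycleZ a D abar Db c f : LL_cocycle a D abar Db f ->
  LL_cocycle a D abar Db (c *: f).
Proof.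
rewrite /LL_cocycle => H; autorewrite with comp; apply: (eq_sub_mul (c%:MP : {mpoly C[3]}) H).
by mpoly_ring.
Qed.

(* Setting [Mv] to 0 in the cocycle equation exhibits [(α - αbar) f] as a
   coboundary. *)
Lemma LL_cocycle_neq a D abar Db f : a != abar -> LL_cocycle a D abar Db f ->
  exists r, f + coboundary a D abar Db r = 0.
Proof.
move=> ne H; exists (- (a - abar)^-1 *: ev f 'X_ord0 0).
have := congr1 (fun P => P \mPo [tuple D2; L2; 0]) H.
have ca : (a%:MP - abar%:MP) * (a - abar)^-1%:MP = 1 :> {mpoly C[2]}.
  by rewrite -mpolyCB -mpolyCM divff ?mpolyC1 // subr_eq0.
have eX k (x : {mpoly C[k]}) : ev1 (ev f 'X_ord0 0) x = ev f x 0.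
  by rewrite /ev1 comp_ev comp_mpolyXU comp0.
rewrite /coboundary; autorewrite with comp.
have eZ k c (p : {mpoly C[1]}) (x : {mpoly C[k]}) : ev1 (c *: p) x = c *: ev1 p x.
  exact: compZ.
rewrite !eZ !eX !addr0 !ev_id => E; rewrite -{1}[f]mul1r -ca.
rewrite !scaleNr mulrN mulrN.
apply: (eq_sub_mul ((a - abar)^-1%:MP : {mpoly C[2]}) E); mpoly_ring.
Qed.

(** At λ = 0 the equation reduces to (α - αbar) h = 0. *)
Lemma LY_cocycle_neq a D abar Db h : a != abar -> LY_cocycle a D abar Db h ->
  h = 0.
Proof.
move=> ne H; have := congr1 (fun P => P \mPo [tuple D2; 0; L2]) H.
autorewrite with comp; rewrite !addr0 !add0r !ev_id => E.
apply/eqP; have : (a - abar)%:MP * h == 0.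
  rewrite mpolyCB; apply/eqP; apply: (eq_sub_mul (-1) E); mpoly_ring.
by rewrite mulf_eq0 mpolyC_eq0 subr_eq0 (negPf ne).
Qed.

(** * Reduction to α = 0 by translating ∂ *)

Definition tr c f := ev f (D2 + c%:MP) L2.

Lemma trK c f : tr (- c) (tr c f) = f.
Proof.
rewrite /tr; autorewrite with comp.
by rewrite -addrA -mpolyCD addNr mpolyC0 addr0 ev_id.
Qed.

Lemma LL_cocycle_tr a D Db c f : LL_cocycle a D a Db f ->
  LL_cocycle (a + c) D (a + c) Db (tr c f).
Proof.
move/(congr1 (fun P => P \mPo [tuple Dv + c%:MP; Lv; Mv])).
rewrite /LL_cocycle /tr; autorewrite with comp.
set s := ev f (Dv + c%:MP + Lv) Mv; have -> : ev f (Dv + Lv + c%:MP) Mv = s by rewrite addrAC.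
set s0 := ev f (Dv + c%:MP + Mv) Lv; have -> : ev f (Dv + Mv + c%:MP) Lv = s0 by rewrite addrAC.
move=> E; apply: (eq_sub_eq E).
by rewrite !mpolyCD; mpoly_ring.
Qed.

Lemma LY_cocycle_tr a D Db c f : LY_cocycle a D a Db f ->
  LY_cocycle (a + c) D (a + c) Db (tr c f).
Proof.
move/(congr1 (fun P => P \mPo [tuple Dv + c%:MP; Lv; Mv])).
rewrite /LY_cocycle /tr; autorewrite with comp.
set s := ev f (Dv + c%:MP + Lv) Mv; have -> : ev f (Dv + Lv + c%:MP) Mv = s by rewrite addrAC.
move=> E; apply: (eq_sub_eq E).
by rewrite !mpolyCD; mpoly_ring.
Qed.

Lemma coboundary_tr a D Db c r :
  tr c (coboundary a D a Db r) =
  coboundary (a + c) D (a + c) Db (ev1 r ('X_ord0 + c%:MP)).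
Proof.
have eX k (x : {mpoly C[k]}) : ev1 (ev1 r ('X_ord0 + c%:MP)) x = ev1 r (x + c%:MP).
  by rewrite /ev1 comp_ev1 compD comp_mpolyXU compC.
rewrite /tr /coboundary !eX; autorewrite with comp.
set s := ev1 r (D2 + c%:MP + L2).
have -> : ev1 r (D2 + L2 + c%:MP) = s by rewrite addrAC.
by rewrite !mpolyCD; mpoly_ring.
Qed.

Lemma is_conf_module_tr a D Db c f g h : is_conf_module a D a Db f g h ->
  is_conf_module (a + c) D (a + c) Db (tr c f) (tr c g) (tr c h).
Proof.
case/conf_moduleP => Hf -> Hh; apply/conf_moduleP; split.
- exact: LL_cocycle_tr.
- exact: ev0.
- exact: LY_cocycle_tr.
Qed.

Lemma ext_equiv_tr a D Db c f g h f' g' h' :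
  ext_equiv a D a Db f g h f' g' h' ->
  ext_equiv (a + c) D (a + c) Db (tr c f) (tr c g) (tr c h)
    (tr c f') (tr c g') (tr c h').
Proof.
case/ext_equivP => r [-> -> ->]; apply/ext_equivP.
by exists (ev1 r ('X_ord0 + c%:MP)); split=> //; rewrite -coboundary_tr; exact: evD.
Qed.

(** * The cocycle equations on coefficients *)

Lemma mcoeff_add k (p q : {mpoly C[k]}) M : (p + q)@_M = p@_M + q@_M.
Proof. exact: mcoeffD. Qed.
Lemma mcoeff_opp k (p : {mpoly C[k]}) M : (- p)@_M = - p@_M.
Proof. exact: mcoeffN. Qed.
Lemma mcoeff_scale k c (p : {mpoly C[k]}) M : (c *: p)@_M = c * p@_M.
Proof. exact: mcoeffZ. Qed.
Lemma coef_ev_DL f k i j : (ev f Dv Lv)@_(mon3 k i j) = f@_(mon2 k i) * (j == 0%N)%:R.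
Proof.
apply: mcoeff_comp2 => u v; rewrite -[_ * _]mulr1 -(expr0 Mv) mcoeff_mon3.
by rewrite -natrM mulnb andbA [_ && (0%N == j)]andbC [0%N == j]eq_sym.
Qed.
Lemma coef_ev_DM f k i j : (ev f Dv Mv)@_(mon3 k i j) = f@_(mon2 k j) * (i == 0%N)%:R.
Proof.
apply: mcoeff_comp2 => u v.
rewrite -[Dv ^+ u]mulr1 -(expr0 Lv) mcoeff_mon3.
by rewrite -natrM mulnb [0%N == i]eq_sym andbCA.
Qed.
Lemma coef_ev_DLM f k i j :
  (ev f (Dv + Lv) Mv)@_(mon3 k i j) = f@_(mon2 (k + i) j) * 'C(k + i, i)%:R.
Proof.
apply: mcoeff_comp2 => u v; rewrite exprDn mulr_suml raddf_sum /=.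
under eq_bigr => s _ do
  rewrite mulrnAl mcoeffMn mcoeff_mon3 andbA -mulnb natrM -mulrnAl.
by rewrite -mulr_suml sum_bin_delta -mulrA -natrM mulnb.
Qed.
Lemma coef_ev_DML f k i j :
  (ev f (Dv + Mv) Lv)@_(mon3 k i j) = f@_(mon2 (k + j) i) * 'C(k + j, j)%:R.
Proof.
apply: mcoeff_comp2 => u v; rewrite exprDn mulr_suml raddf_sum /=.
under eq_bigr => s _ do
  rewrite mulrnAl mcoeffMn mulrAC mcoeff_mon3 [(v == i) && _]andbC andbA -mulnb natrM -mulrnAl.
by rewrite -mulr_suml sum_bin_delta -mulrA -natrM mulnb.
Qed.
Lemma coef_ev_LM f k i j :
  (ev f Dv (Lv + Mv))@_(mon3 k i j) = f@_(mon2 k (i + j)) * 'C(i + j, j)%:R.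
Proof.
apply: mcoeff_comp2 => u v; rewrite exprDn mulr_sumr raddf_sum /=.
under eq_bigr => s _ do
  rewrite mulrnAr mulrA mcoeffMn mcoeff_mon3 -mulnb natrM -mulrnAr.
by rewrite -mulr_sumr sum_bin_delta mulrCA -natrM mulnb.
Qed.
Lemma coef_ev1_D2 r k i :
  (ev1 r D2)@_(mon2 k i) = r@_[multinom [tuple k]] * (i == 0%N)%:R.
Proof.
apply: mcoeff_comp1 => u; rewrite -[_ ^+ _]mulr1 -(expr0 L2) mcoeff_mon2.
by rewrite -natrM mulnb [0%N == i]eq_sym andbC.
Qed.
Lemma coef_ev1_DL2 r k i :
  (ev1 r (D2 + L2))@_(mon2 k i) =
  r@_[multinom [tuple (k + i)%N]] * 'C(k + i, i)%:R.
Proof.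
apply: mcoeff_comp1 => u; rewrite exprDn raddf_sum /=.
under eq_bigr => s _ do rewrite mcoeffMn mcoeff_mon2.
by rewrite sum_bin_delta.
Qed.

#[local] Hint Rewrite mcoeff_add mcoeff_opp mcoeff_scale mcoeff_Dv mcoeff_Lv mcoeff_Mv mcoeff_D2
  mcoeff_L2 coef_ev_DL coef_ev_DM coef_ev_DLM coef_ev_DML coef_ev_LM
  coef_ev1_D2 coef_ev1_DL2 : coef.

Lemma coef_Dv_DL f k i j : (Dv * ev f Dv Lv)@_(mon3 k i j.+1) = 0.
Proof. by rewrite mcoeff_Dv; case: k => // k; rewrite coef_ev_DL mulr0. Qed.
Lemma coef_Dv_DM f k i j : (Dv * ev f Dv Mv)@_(mon3 k i.+1 j) = 0.
Proof. by rewrite mcoeff_Dv; case: k => // k; rewrite coef_ev_DM mulr0. Qed.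
(** For k = 0 the binomial coefficient vanishes, which absorbs the boundary case and spares a case
    split on k. *)
Lemma coef_Dv_DLM f k i j : (Dv * ev f (Dv + Lv) Mv)@_(mon3 k i.+1 j) =
  f@_(mon2 (k + i) j) * 'C(k + i, i.+1)%:R.
Proof.
rewrite mcoeff_Dv; case: k => [|k]; first by rewrite bin_small ?mulr0.
by rewrite coef_ev_DLM addSnnS.
Qed.
Lemma coef_Dv_DML f k i j : (Dv * ev f (Dv + Mv) Lv)@_(mon3 k i j.+1) =
  f@_(mon2 (k + j) i) * 'C(k + j, j.+1)%:R.
Proof.
rewrite mcoeff_Dv; case: k => [|k]; first by rewrite bin_small ?mulr0.
by rewrite coef_ev_DML addSnnS.
Qed.
#[local] Hint Rewrite mcoeff_add mcoeff_opp mcoeff_scale coef_Dv_DL coef_Dv_DM coef_Dv_DLM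
  coef_Dv_DML : coef1.

(** Expanded so that every term is a variable times a substitution, as the coefficient rules
    require. *)
Lemma LL_cocycle0E D Db f : LL_cocycle 0 D 0 Db f ->
  Dv * ev f Dv Lv + Lv * ev f Dv Lv + D *: (Mv * ev f Dv Lv)
  + Dv * ev f (Dv + Lv) Mv + Db *: (Lv * ev f (Dv + Lv) Mv)
  - (Dv * ev f Dv Mv + Mv * ev f Dv Mv + D *: (Lv * ev f Dv Mv)
     + Dv * ev f (Dv + Mv) Lv + Db *: (Mv * ev f (Dv + Mv) Lv))
  = Lv * ev f Dv (Lv + Mv) - Mv * ev f Dv (Lv + Mv).
Proof.
rewrite /LL_cocycle mpolyC0 !addr0 => E; apply: (eq_sub_eq E).
by mpoly_ring.
Qed.

Lemma LY_cocycle0E D Db h : LY_cocycle 0 D 0 Db h ->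
  Dv * ev h (Dv + Lv) Mv + Db *: (Lv * ev h (Dv + Lv) Mv)
  - (Dv * ev h Dv Mv + Mv * ev h Dv Mv + D *: (Lv * ev h Dv Mv))
  = (1 / 2%:R) *: (Lv * ev h Dv (Lv + Mv)) - Mv * ev h Dv (Lv + Mv).
Proof.
rewrite /LY_cocycle mpolyC0 !addr0 => E; apply: (eq_sub_eq E).
by mpoly_ring.
Qed.

Lemma coef_col0 D Db f n : LL_cocycle 0 D 0 Db f -> Db * f@_(mon2 n.+1 0) = 0.
Proof.
move/LL_cocycle0E/(congr1 (fun P => P@_(mon3 0 n.+2 0))).
autorewrite with coef => /=; rewrite ?(add0n, addn0) ?binn ?bin0 => E.
by apply: (eq_sub_eq E); ring.
Qed.

Lemma coef_00 D Db f : LL_cocycle 0 D 0 Db f -> (D - Db) * f@_(mon2 0 0) = 0.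
Proof.
move/LL_cocycle0E/(congr1 (fun P => P@_(mon3 0 1 0))).
autorewrite with coef => /=; rewrite ?(add0n, addn0) ?binn ?bin0 => E.
by apply: (eq_sub_mul (-1) E); ring.
Qed.

(** The coefficient of μ^1 expresses the action of L_0. Once column 1 (the coefficients of λ^1)
    vanishes, a nonzero entry in a later column must have total degree Δ - Δbar + 1. *)
Lemma coef_col1 D Db f k i : LL_cocycle 0 D 0 Db f ->
  (D - Db - (k + i.+1)%:R) * f@_(mon2 k i.+2) =
  - ('C(k + i.+1, i.+2)%:R + Db * 'C(k + i.+1, i.+1)%:R) * f@_(mon2 (k + i.+1) 1).
Proof.
move/LL_cocycle0E/(congr1 (fun P => P@_(mon3 k i.+2 1))).
autorewrite with coef1; autorewrite with coef => /=.
rewrite ?addn0 addn1 !bin1 bin0 => E.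
by apply: (eq_sub_eq E); rewrite !natrD -!natr1; ring.
Qed.

(** With λ and μ both to a power at least 2, Δ drops out. For i <> j the relation computes column
    i+j+3 from columns i+2 and j+2 in the same total degree; for i = j both sides vanish. *)
Lemma coef_gen D Db f k i j : LL_cocycle 0 D 0 Db f ->
  ('C(k + i.+1, i.+2)%:R + Db * 'C(k + i.+1, i.+1)%:R) * f@_(mon2 (k + i.+1) j.+2)
  - ('C(k + j.+1, j.+2)%:R + Db * 'C(k + j.+1, j.+1)%:R) * f@_(mon2 (k + j.+1) i.+2)
  = ('C(i + j + 3, i.+1)%:R - 'C(i + j + 3, i.+2)%:R) * f@_(mon2 k (i + j + 3)).
Proof.
move/LL_cocycle0E/(congr1 (fun P => P@_(mon3 k i.+2 j.+2))).
autorewrite with coef1; autorewrite with coef => /=.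
have -> : (i.+1 + j.+2 = i + j + 3)%N by rewrite addSnnS addn3 !addnS.
have -> : (i.+2 + j.+1 = i + j + 3)%N by rewrite addn3 !addSn !addnS.
have -> : 'C(i + j + 3, j.+2) = 'C(i + j + 3, i.+1).
  by rewrite -[RHS]bin_sub; [congr 'C(_, _) |]; rewrite addn3; lia.
have -> : 'C(i + j + 3, j.+1) = 'C(i + j + 3, i.+2).
  by rewrite -[RHS]bin_sub; [congr 'C(_, _) |]; rewrite addn3; lia.
by move=> E; apply: (eq_sub_eq E); ring.
Qed.

(** Links column i+j+1 of h to its column j, again without Δ. *)
Lemma coef_LY D Db h k i j : LY_cocycle 0 D 0 Db h ->
  ('C(k + i.+1, i.+2)%:R + Db * 'C(k + i.+1, i.+1)%:R) * h@_(mon2 (k + i.+1) j)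
  = (1 / 2%:R * 'C(i + j + 1, i.+1)%:R - 'C(i + j + 1, i.+2)%:R)
    * h@_(mon2 k (i + j + 1)).
Proof.
move/LY_cocycle0E/(congr1 (fun P => P@_(mon3 k i.+2 j))).
autorewrite with coef1; autorewrite with coef => /=.
have -> : (i + j + 1 = i.+1 + j)%N by rewrite addn1 addSn.
have e : 'C(i.+1 + j, i.+1) = 'C(i.+1 + j, j).
  by rewrite -[RHS]bin_sub ?leq_addl // addnK.
case: j e => [|j] /= ->.
  rewrite !addn0 bin0 => E; rewrite [in RHS]bin_small //.
  by apply: (eq_sub_eq E); ring.
autorewrite with coef; rewrite [(i.+2 + j)%N]addSnnS => E.
have e : 'C(i.+1 + j.+1, i.+2) = 'C(i.+1 + j.+1, j).
  by rewrite -addSnnS -[RHS]bin_sub ?leq_addl // addnK.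
have z : (i.+2 == 0%N)%:R = 0 :> C by [].
by apply: (eq_sub_eq E); rewrite e z; ring.
Qed.

(** The action of L_0 again: h is homogeneous of degree Δ - Δbar + 1/2. *)
Lemma coef_LY1 D Db h k j : LY_cocycle 0 D 0 Db h ->
  (D - Db + 1 / 2%:R - (k + j)%:R) * h@_(mon2 k j) = 0.
Proof.
move/LY_cocycle0E/(congr1 (fun P => P@_(mon3 k 1 j))).
autorewrite with coef1; autorewrite with coef; rewrite !addn0 !bin0 !bin1.
case: j => [|j] E.
  by apply: (eq_sub_mul (-1) E); rewrite /= !addn0 bin0; ring.
move: E; cbv iota; autorewrite with coef => E; apply: (eq_sub_mul (-1) E).
have o : (0%N == 0%N)%:R = 1 :> C by [].
have z : (1%N == 0%N)%:R = 0 :> C by [].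
by rewrite o z !add0n !binn add1n binSn natrD -[j.+1%:R]natr1; ring.
Qed.

Lemma coef_coboundary D Db r k i :
  (coboundary 0 D 0 Db r)@_(mon2 k i.+2) =
  - ('C(k + i.+1, i.+2)%:R + Db * 'C(k + i.+1, i.+1)%:R)
  * r@_[multinom [tuple (k + i.+1)%N]].
Proof.
rewrite /coboundary mpolyC0 !addr0 !mulrDl -!scalerAl.
have z m : (m.+1 == 0%N)%:R = 0 :> C by [].
autorewrite with coef; case: k => [|k]; cbv iota; autorewrite with coef.
  by rewrite z add0n (bin_small (ltnSn i.+1)); ring.
by rewrite !z addSnnS; ring.
Qed.

Lemma coef_coboundary0 D Db r k : (coboundary 0 D 0 Db r)@_(mon2 k 0) = 0.
Proof.
rewrite /coboundary mpolyC0 !addr0 !mulrDl -!scalerAl.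
autorewrite with coef; case: k => [|k]; cbv iota; autorewrite with coef.
  by ring.
have o : (0%N == 0%N)%:R = 1 :> C by [].
by rewrite o addn0 bin0; ring.
Qed.

Lemma coef_coboundary1 D Db r k : (coboundary 0 D 0 Db r)@_(mon2 k 1) =
  (D - Db - k%:R) * r@_[multinom [tuple k]].
Proof.
rewrite /coboundary mpolyC0 !addr0 !mulrDl -!scalerAl.
autorewrite with coef; rewrite addn0 bin0.
have o : (0%N == 0%N)%:R = 1 :> C by [].
case: k => [|k]; cbv iota; autorewrite with coef.
  by rewrite o; ring.
have z : (1%N == 0%N)%:R = 0 :> C by [].
by rewrite addn1 bin1 o z; ring.
Qed.

Lemma mnm2E (m : 'X_{1..2}) : m = mon2 (m ord0) (m (lift ord0 ord0)).
Proof. by apply/eqP; rewrite mon2P !eqxx. Qed.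

Lemma mpoly2_eq0 f : (forall k i, f@_(mon2 k i) = 0) -> f = 0.
Proof. by move=> H; apply/mpolyP => m; rewrite mcoeff0 (mnm2E m) H. Qed.

Lemma mpoly2_neq0 f : f != 0 -> exists k i, f@_(mon2 k i) != 0.
Proof.
move=> f0; exists (mlead f ord0), (mlead f (lift ord0 ord0)).
by rewrite -mnm2E mleadc_eq0.
Qed.

Lemma mpoly1_exists (c : nat -> C) B : exists r : {mpoly C[1]},
  forall k, r@_[multinom [tuple k]] = if (k < B)%N then c k else 0.
Proof.
elim: B => [|B [r IH]]; first by exists 0 => k; rewrite mcoeff0.
exists (r + c B *: 'X_[[multinom [tuple B]]]) => k.
rewrite mcoeffD mcoeffZ mcoeffX IH ltnS [(k <= B)%N]leq_eqVlt.
have -> : ([multinom [tuple B]] == [multinom [tuple k]] :> 'X_{1..1}) = (k == B).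
  apply/eqP/eqP => [/(congr1 (fun m : 'X_{1..1} => m ord0)) // | -> //].
case: (k =P B) => [-> | _] /=; first by rewrite ltnn mulr1 add0r.
by rewrite mulr0 addr0.
Qed.

Lemma mcoeff_large f i : exists B, forall k, (B <= k)%N -> f@_(mon2 k i) = 0.
Proof.
exists (msize f) => k le_k; apply/eqP; rewrite mcoeff_eq0.
apply: contraTN le_k => /msize_mdeg_lt; rewrite -ltnNge; apply: leq_trans.
by rewrite ltnS mdegE big_ord_recl leq_addr.
Qed.

(** Iterated, this turns binomial coefficients into polynomials in n, which [field] can handle; it
    holds for n < i too, both sides being 0. *)
Lemma binR n i : 'C(n, i.+1)%:R = 'C(n, i)%:R * (n%:R - i%:R) / (i%:R + 1) :> C.
Proof.
have nz : i%:R + 1 != 0 :> C by rewrite natr1 pnatr_eq0.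
apply: (mulIf nz); rewrite mulfVK // natr1 -natrM mulnC mul_bin_left natrM mulrC.
have [le_in | lt_ni] := leqP i n; first by rewrite natrB.
by rewrite bin_small // !mul0r.
Qed.

(** * Cocycles of weight [D - Db] *)

Section Weights.
Variables D Db : C.
Hypothesis Db0 : Db != 0.
Notation LL := (LL_cocycle 0 D 0 Db).
Notation cob := (coboundary 0 D 0 Db).

(** Outside the critical degree Δ - Δbar + 1, column 1 controls all later columns by [coef_col1]; in
    that degree columns 2 and 3 generate the others. *)
Lemma LL_eq0 f : LL f -> (forall k, f@_(mon2 k 1) = 0) -> f@_(mon2 0 0) = 0 ->
  (forall k, D - Db = k.+1%:R -> f@_(mon2 k 2) = 0) ->
  (forall k, D - Db = k.+2%:R -> f@_(mon2 k 3) = 0) -> f = 0.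
Proof.
move=> Hf H1 H0 H2 H3; apply: mpoly2_eq0.
have P i : forall k, D - Db = (k + i.+1)%:R -> f@_(mon2 k i.+2) = 0.
  elim/ltn_ind: i => -[|[|i]] IH k E.
  - by apply: H2; rewrite E addn1.
  - by apply: H3; rewrite E addn2.
  (* Column i+4 from columns 2 and i+3; its factor is -(i+4)(i+1)/2, which is nonzero. *)
  have := coef_gen k 0 i.+1 Hf.
  rewrite IH //; last by rewrite E; congr _%:R; lia.
  rewrite IH //; last by rewrite E; congr _%:R; lia.
  rewrite !mulr0 subrr add0n addn3 => /esym/eqP; rewrite mulf_eq0 => /orP[|/eqP //].
  rewrite subr_eq0 eqr_nat => /eqP e.
  by have := mul_bin_left i.+4 1; rewrite -e bin1; nia.
move=> k [|[|i]] //.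
  by case: k => // k; apply/eqP; have /eqP := coef_col0 k Hf; rewrite mulf_eq0 (negPf Db0).
have /eqP := coef_col1 k i Hf; rewrite H1 mulr0 mulf_eq0 subr_eq0 => /orP[/eqP|/eqP //].
exact: P.
Qed.

(* [- t2 m] and [- t3 m] are the coefficients of [λ^2] and [λ^3] in the
   coboundary of [∂^(m+1)]. *)
Definition t2 m : C := 'C(m.+1, 2)%:R + Db * 'C(m.+1, 1)%:R.
Definition t3 m : C := 'C(m.+1, 3)%:R + Db * 'C(m.+1, 2)%:R.
(** Here m = Δ - Δbar - 1, so both entries of f lie in the critical degree m+2. For m = 0 there is
    no ∂^(-1) λ^3, hence the default 0. *)
Definition disc m f : C :=
  f@_(mon2 m 2) * t3 m - (if m is m'.+1 then f@_(mon2 m' 3) else 0) * t2 m.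

Lemma discD m f g : disc m (f + g) = disc m f + disc m g.
Proof. by rewrite /disc; case: m => [|m]; rewrite !mcoeffD; ring. Qed.

Lemma discZ m c f : disc m (c *: f) = c * disc m f.
Proof. by rewrite /disc; case: m => [|m]; rewrite !mcoeffZ; ring. Qed.

(** With additivity, this makes [disc] constant on equivalence classes, which is how the listed f
    are shown nontrivial. *)
Lemma disc_cob m r : disc m (cob r) = 0.
Proof.
rewrite /disc coef_coboundary /t3 /t2; case: m => [|m].
  by rewrite (_ : 'C(1, 3) = 0%N) // (_ : 'C(1, 2) = 0%N) //; ring.
by rewrite coef_coboundary addn1 addn2; ring.
Qed.

Lemma t2t3_neq0 m : (t2 m != 0) || (t3 m != 0).
Proof.
rewrite -negb_and; apply/negP => /andP[/eqP E2 /eqP E3].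
have n0 : m.+1%:R != 0 :> C by rewrite pnatr_eq0.
case: m n0 E2 E3 => [|m] n0; rewrite /t2 /t3 => E2 E3.
  by case/eqP: Db0; rewrite -E2 (_ : 'C(1, 2) = 0%N) // bin1; ring.
have : m.+1%:R * m.+2%:R * m.+3%:R = 0 :> C.
  (* This combination eliminates [Db]. *)
  transitivity (12%:R * ((m%:R + 1) / 2%:R * t2 m.+1 - t3 m.+1)).
    by rewrite /t2 /t3 !binR bin0 -!natr1; field.
  by rewrite /t2 /t3 E2 E3; ring.
by move/eqP; rewrite !mulf_eq0 !pnatr_eq0.
Qed.
End Weights.

(** * Binomial coefficients as explicit polynomials *)

Lemma binR2 n : 'C(n, 2)%:R = n%:R * (n%:R - 1) / 2%:R :> C.
Proof. by rewrite !binR bin0; field. Qed.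
Lemma binR3 n : 'C(n, 3)%:R = n%:R * (n%:R - 1) * (n%:R - 2%:R) / 6%:R :> C.
Proof. by rewrite binR binR2; field. Qed.
Lemma binR4 n : 'C(n, 4)%:R =
  n%:R * (n%:R - 1) * (n%:R - 2%:R) * (n%:R - 3%:R) / 24%:R :> C.
Proof. by rewrite binR binR3; field. Qed.
Lemma binR5 n : 'C(n, 5)%:R = n%:R * (n%:R - 1) * (n%:R - 2%:R)
  * (n%:R - 3%:R) * (n%:R - 4%:R) / 120%:R :> C.
Proof. by rewrite binR binR4; field. Qed.
Lemma binR6 n : 'C(n, 6)%:R = n%:R * (n%:R - 1) * (n%:R - 2%:R)
  * (n%:R - 3%:R) * (n%:R - 4%:R) * (n%:R - 5%:R) / 720%:R :> C.
Proof. by rewrite binR binR5; field. Qed.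
Lemma binR7 n : 'C(n, 7)%:R = n%:R * (n%:R - 1) * (n%:R - 2%:R)
  * (n%:R - 3%:R) * (n%:R - 4%:R) * (n%:R - 5%:R) * (n%:R - 6%:R) / 5040%:R :> C.
Proof. by rewrite binR binR6; field. Qed.
#[local] Hint Rewrite bin1 binR2 binR3 binR4 binR5 binR6 binR7 : bin.

(** Since q.+n is convertible to n + q, [natrD] splits it; the image of q then becomes an arbitrary
    scalar, so that a rational identity remains. *)
Ltac expand_bin q :=
  autorewrite with bin;
  rewrite ?(natrD C 1 q) ?(natrD C 2 q) ?(natrD C 3 q) ?(natrD C 4 q)
    ?(natrD C 5 q) ?(natrD C 6 q) ?(natrD C 7 q);
  move: (q%:R : C).

(** * Weights that admit a nontrivial f *)

Section Exceptional.
Variables D Db : C.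
Hypothesis Db0 : Db != 0.
Notation LL := (LL_cocycle 0 D 0 Db).
Notation cob := (coboundary 0 D 0 Db).

Lemma LL_disc0 m f : D - Db = m.+1%:R -> LL f ->
  (forall k, f@_(mon2 k 1) = 0) -> f@_(mon2 0 0) = 0 -> disc Db m f = 0 ->
  exists r, f + cob r = 0.
Proof.
move=> Dm Hf H1 H0 Hd.
have [rho [E2 E3]] : exists rho, f@_(mon2 m 2) = rho * t2 Db m /\
    (if m is m'.+1 then f@_(mon2 m' 3) else 0) = rho * t3 Db m.
  move: Hd; rewrite /disc; set a3 := (X in X * t2 _ _) => Hd.
  case/orP: (t2t3_neq0 Db0 m) => nz.
    exists (f@_(mon2 m 2) / t2 Db m); rewrite mulfVK //; split=> //.
    by apply: (mulIf nz); rewrite mulrAC mulfVK //; apply/esym/subr0_eq.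
  exists (a3 / t3 Db m); rewrite mulfVK //; split=> //.
  by apply: (mulIf nz); rewrite mulrAC mulfVK //; apply/subr0_eq.
(* This is r = rho ∂^(m+1). Its coboundary leaves column 1 alone because D - Db - k vanishes at k =
   m+1. *)
have [r Hr] := mpoly1_exists (fun k => if k == m.+1 then rho else 0) m.+2.
exists r; apply: (LL_eq0 Db0) => [|k||k|k].
- exact: LL_cocycleD Hf (LL_cocycle_coboundary _ _ _ _ _).
- rewrite mcoeffD H1 coef_coboundary1 Dm Hr add0r.
  case: ifP => _; last by rewrite mulr0.
  by case: eqP => [->|_]; rewrite ?subrr ?mul0r ?mulr0.
- by rewrite mcoeffD H0 coef_coboundary0 add0r.
- rewrite Dm => /eqP; rewrite eqr_nat eqSS => /eqP <-.
  rewrite mcoeffD coef_coboundary E2 Hr addn1 ltnSn eqxx /t2; ring.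
rewrite Dm => /eqP; rewrite eqr_nat eqSS => /eqP e; move: Hr E3; rewrite e => Hr E3.
by rewrite mcoeffD coef_coboundary E3 Hr addn2 ltnSn eqxx /t3; ring.
Qed.

(** A coboundary can clear column 1 except at k = D - Db; there [coef_col1] already forces 0 because
    [Db] is nonzero, unless k = 0. *)
Lemma LL_normalize f : LL f -> exists r f1, f1 = f + cob r /\
  forall k : nat, (k == 0)%N ==> (D != Db) -> f1@_(mon2 k 1) = 0.
Proof.
move=> Hf; have [B HB] := mcoeff_large f 1.
have [r Hr] := mpoly1_exists (fun k => - f@_(mon2 k 1) / (D - Db - k%:R)) B.
have Hfr := LL_cocycleD Hf (LL_cocycle_coboundary 0 D 0 Db r).
exists r, (f + cob r); split=> // k; have [Dk | nDk] := eqVneq (D - Db) k%:R.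
  case: k Dk => [/eqP|k Dk _]; first by rewrite subr_eq0 => ->.
  have /eqP := coef_col1 0 k Hfr.
  rewrite !add0n Dk subrr mul0r binn bin_small // add0r mulr1 eq_sym mulf_eq0.
  by rewrite oppr_eq0 (negPf Db0) => /eqP.
move=> _; rewrite mcoeffD coef_coboundary1 Hr; case: ltnP => [_ | /HB ->].
  by rewrite mulrCA divff ?mulr1 ?subrr // subr_eq0.
by rewrite mulr0 addr0.
Qed.

Lemma LL_weight f : LL f -> f@_(mon2 0 0) = 0 -> (forall k, f@_(mon2 k 1) = 0) ->
  f != 0 -> exists m, D - Db = m.+1%:R.
Proof.
move=> Hf H0 H1 /mpoly2_neq0 [k [[|[|i]] nz]].
- case: k nz => [|k] nz; first by rewrite H0 eqxx in nz.
  by have /eqP := coef_col0 k Hf; rewrite mulf_eq0 (negPf Db0) (negPf nz).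
- by rewrite H1 eqxx in nz.
exists (k + i)%N; have /eqP := coef_col1 k i Hf.
by rewrite H1 mulr0 mulf_eq0 (negPf nz) orbF subr_eq0 addnS => /eqP.
Qed.

(* Comparing the two expressions of [f@_(mon2 p 6)] in terms of the
   coefficients of [λ^2] and [λ^3]. *)
Lemma LL_elim6 p f : LL f ->
  (p%:R + 3%:R) * (p%:R + 2%:R) * (p%:R + 1) *
  ((p%:R + 5%:R) * p%:R + 4%:R * Db * (p%:R + 4%:R) + 4%:R * Db ^+ 2)
  * disc Db p.+4 f = 0.
Proof.
move=> Hf.
have := coef_gen p 1 2 Hf; have := coef_gen p 0 3 Hf.
have := coef_gen (p + 1) 0 2 Hf; have := coef_gen (p + 2) 0 1 Hf.
rewrite /disc /t2 /t3 -!addnA /= ?addn1 ?addn2 ?addn3 ?addn4 ?addnS ?addn0.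
move: (f@_(mon2 p.+4 2)) (f@_(mon2 p.+3 3)) (f@_(mon2 p.+2 4))
  (f@_(mon2 p.+1 5)) (f@_(mon2 p 6)) => a2 a3 a4 a5 a6.
move=> /eqP; rewrite -subr_eq0; set X23 := (X in X == 0) => /eqP E23.
move=> /eqP; rewrite -subr_eq0; set X24 := (X in X == 0) => /eqP E24.
move=> /eqP; rewrite -subr_eq0; set X25 := (X in X == 0) => /eqP E25.
move=> /eqP; rewrite -subr_eq0; set X34 := (X in X == 0) => /eqP E34.
pose A52 : C := 'C(p.+1, 2)%:R + Db * 'C(p.+1, 1)%:R.
pose A42 : C := 'C(p.+2, 2)%:R + Db * 'C(p.+2, 1)%:R.
pose A43 : C := 'C(p.+2, 3)%:R + Db * 'C(p.+2, 2)%:R.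
(* The multipliers of [X25], [X24] and [X23] cancel a6, a5 and a4 in turn. The factor p + 5 is
   common to [t2] and [t3] at p+4. *)
transitivity (72%:R * (p%:R + 5%:R) * (X34 - 5%:R / 9%:R * X25 + A52 / 9%:R * X24
  - (A43 + A52 * A42 / 9%:R) / 2%:R * X23)); last first.
  by rewrite E23 E24 E25 E34; ring.
rewrite /X34 /X25 /X24 /X23 /A52 /A42 /A43; expand_bin p; move=> x; by field.
Qed.

(* The same for [f@_(mon2 q 8)]. *)
Lemma LL_elim8 q f : LL f ->
  (q%:R + 5%:R) * (q%:R + 4%:R) * (q%:R + 3%:R) * (q%:R + 2%:R) * (q%:R + 1) *
  (3%:R * (q%:R + 7%:R) * (q%:R + 6%:R)
   - (12%:R * Db ^+ 2 + 12%:R * (q%:R + 8%:R) * Db - 84%:R * Db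
      + 3%:R * (q%:R + 8%:R) ^+ 2 - 43%:R * (q%:R + 8%:R) + 161%:R)
   * ((q%:R + 7%:R) * (q%:R + 2%:R) + 4%:R * Db * (q%:R + 6%:R) + 4%:R * Db ^+ 2))
  * disc Db q.+2.+4 f = 0.
Proof.
move=> Hf.
have := coef_gen q 1 4 Hf; have := coef_gen q 0 5 Hf.
have := coef_gen (q + 1) 0 4 Hf; have := coef_gen (q + 2) 0 3 Hf.
have := coef_gen (q + 3) 0 2 Hf; have := coef_gen (q + 4) 0 1 Hf.
rewrite /disc /t2 /t3 -!addnA /= ?addn1 ?addn2 ?addn3 ?addn4 ?addnS ?addn0.
move: (f@_(mon2 q.+2.+4 2)) (f@_(mon2 q.+1.+4 3)) (f@_(mon2 q.+4 4))
  (f@_(mon2 q.+3 5)) (f@_(mon2 q.+2 6)) (f@_(mon2 q.+1 7)) (f@_(mon2 q 8)) => a2 a3 a4 a5 a6 a7 a8.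
move=> /eqP; rewrite -subr_eq0; set X23 := (X in X == 0) => /eqP E23.
move=> /eqP; rewrite -subr_eq0; set X24 := (X in X == 0) => /eqP E24.
move=> /eqP; rewrite -subr_eq0; set X25 := (X in X == 0) => /eqP E25.
move=> /eqP; rewrite -subr_eq0; set X26 := (X in X == 0) => /eqP E26.
move=> /eqP; rewrite -subr_eq0; set X27 := (X in X == 0) => /eqP E27.
move=> /eqP; rewrite -subr_eq0; set X36 := (X in X == 0) => /eqP E36.
pose A42 : C := 'C(q.+4, 2)%:R + Db * 'C(q.+4, 1)%:R.
pose A52 : C := 'C(q.+3, 2)%:R + Db * 'C(q.+3, 1)%:R.
pose A62 : C := 'C(q.+2, 2)%:R + Db * 'C(q.+2, 1)%:R.
pose A63 : C := 'C(q.+2, 3)%:R + Db * 'C(q.+2, 2)%:R.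
pose A72 : C := 'C(q.+1, 2)%:R + Db * 'C(q.+1, 1)%:R.
(* The multiplier 7/5 of [X27] cancels a8; c26, c25, c24 and c23 then cancel a7, a6, a5 and a4. *)
pose c26 := A72 / 10%:R; pose c25 := - (A63 + c26 * A62) / 9%:R.
pose c24 := - (c25 * A52) / 5%:R; pose c23 := - (c24 * A42) / 2%:R.
transitivity (- 43200%:R * (q%:R + 7%:R) * (X36 - 7%:R / 5%:R * X27 + c26 * X26
  + c25 * X25 + c24 * X24 + c23 * X23)); last first.
  by rewrite E23 E24 E25 E26 E27 E36; ring.
rewrite /X36 /X27 /X26 /X25 /X24 /X23 /c23 /c24 /c25 /c26 /A72 /A63 /A62 /A52 /A42.
expand_bin q; move=> x; by field.
Qed.
(** For m = 0, [t3] vanishes. For m = 4 and m = 5 the quadratic factor of [LL_elim6] must vanish,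
    which fixes [Db]. For m = q+6 its vanishing reduces [LL_elim8] to positive factors times
    [disc]. *)
Lemma LL_disc_neq0 m f : LL f -> disc Db m f != 0 ->
  [\/ (0 < m < 4)%N, m = 4%N /\ Db = - 4%:R |
      m = 5%N /\ (2%:R * Db + 5%:R) ^+ 2 = 19%:R].
Proof.
move=> Hf; case: m => [|[|[|[|p]]]] nz; try by constructor 1.
  by case/eqP: nz; rewrite /disc /t2 /t3 !binR; ring.
have n0 k l : k%:R + l.+1%:R != 0 :> C by rewrite -natrD pnatr_eq0 addnS.
have := LL_elim6 p Hf; move/eqP; rewrite mulf_eq0 (negPf nz) orbF.
rewrite -[_ + 1]/(_ + 1%:R) !mulf_eq0 !(negPf (n0 _ _)) /= => /eqP.
case: p nz => [|[|q]] nz E.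
- constructor 2; split=> //; apply/eqP; have : Db * (Db + 4%:R) = 0.
    by apply: (eq_sub_mul (1 / 4%:R) E); field.
  by move/eqP; rewrite mulf_eq0 (negPf Db0) addr_eq0.
- by constructor 3; split=> //; apply: (eq_sub_eq E); ring.
have eY : (q%:R + 7%:R) * (q%:R + 2%:R) + 4%:R * Db * (q%:R + 6%:R)
    + 4%:R * Db ^+ 2 = 0.
  by apply: (eq_sub_eq E); rewrite (natrD C 2 q); ring.
have := LL_elim8 q Hf; rewrite eY mulr0 subr0 => /eqP.
rewrite -[_ + 1]/(_ + 1%:R) mulf_eq0 (negPf nz) orbF !mulf_eq0.
by rewrite !(negPf (n0 _ _)) pnatr_eq0.
Qed.
End Exceptional.

(** * The equation for h *)

Lemma LY_eq0 D Db h : LY_cocycle 0 D 0 Db h ->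
  (forall k, h@_(mon2 k 0) = 0) -> h = 0.
Proof.
move=> Hh H0; apply: mpoly2_eq0 => k i; elim/ltn_ind: i k => -[|[|[|i]]] IH k //.
- have := coef_LY k 0 0 Hh; rewrite H0 mulr0 add0n bin1 bin_small // subr0.
  by move/esym/eqP; rewrite mulr1 mul1r mulf_eq0 invr_eq0 pnatr_eq0 => /eqP.
(* Column 2 has to come from column 0: the relation with i = 0, j = 1 has factor 0 on it. *)
- have := coef_LY k 1 0 Hh; rewrite H0 mulr0 addn0 binn bin_small // subr0.
  by move/esym/eqP; rewrite mulr1 mul1r mulf_eq0 invr_eq0 pnatr_eq0 => /eqP.
have := coef_LY k 0 i.+2 Hh; rewrite IH // mulr0 add0n addn1 => /esym/eqP.
rewrite mulf_eq0 => /orP[|/eqP //]; rewrite bin1 binR2 -!natr1 => /eqP e.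
have : (i%:R + 3%:R) * (i%:R + 1) = 0 :> C.
  by apply: (eq_sub_mul (- 2%:R) e); field.
by move/eqP; rewrite natr1 -natrD -natrM pnatr_eq0 addn3.
Qed.

Lemma LY_weight D Db h : LY_cocycle 0 D 0 Db h -> h != 0 ->
  exists n, [/\ D - Db + 1 / 2%:R = n%:R, h@_(mon2 n 0) != 0 &
    forall k, k != n -> h@_(mon2 k 0) = 0].
Proof.
move=> Hh h0; have [k [i nz]] := mpoly2_neq0 h0.
have w j l : h@_(mon2 j l) != 0 -> D - Db + 1 / 2%:R = (j + l)%:R.
  move=> nz'; have /eqP := coef_LY1 j l Hh.
  by rewrite mulf_eq0 (negPf nz') orbF subr_eq0 => /eqP.
have E := w _ _ nz; set n := (k + i)%N in E.
have U j : j != n -> h@_(mon2 j 0) = 0.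
  apply: contraNeq => /w; rewrite E addn0 => /eqP; rewrite eqr_nat.
  by rewrite eq_sym.
exists n; split=> //; apply: contraNneq h0 => hn; apply/eqP; apply: (LY_eq0 Hh) => j.
by have [-> // | /U] := eqVneq j n.
Qed.

Lemma LY_constraint D Db h n : Db != 0 -> LY_cocycle 0 D 0 Db h ->
  h@_(mon2 n 0) != 0 -> [\/ n = 0%N, n = 1%N | n = 2%N /\ Db = - (1 / 2%:R)].
Proof.
move=> Db0 Hh; case: n => [|[|k]] b0; [by constructor 1 | by constructor 2 |].
constructor 3.
(* The first relation gives column 1 from column 0, the second annihilates a multiple of column 1;
   together they make (2 Db + k + 1)(2 Db + k) vanish. *)
have := coef_LY k.+1 0 0 Hh; have := coef_LY k 0 1 Hh.
rewrite !add0n !addn1 => /eqP; rewrite -subr_eq0; set X1 := (X in X == 0) => /eqP E1.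
move=> /eqP; rewrite -subr_eq0; set X0 := (X in X == 0) => /eqP E0.
have : (k%:R + 2%:R) * (k%:R + 1) * ((2%:R * Db + k%:R + 1) * (2%:R * Db + k%:R))
   * h@_(mon2 k.+2 0) = 0.
  transitivity (4%:R * ((k%:R + 1) * (k%:R / 2%:R + Db)) * X0 + 2%:R * X1); last first.
    by rewrite E1 E0; ring.
  rewrite /X0 /X1; expand_bin k; move=> x; by field.
have n0 (u v : nat) : u%:R + v.+1%:R != 0 :> C by rewrite -natrD pnatr_eq0 addnS.
rewrite -[k%:R + 1]/(k%:R + 1%:R); move/eqP.
rewrite mulf_eq0 (negPf b0) orbF !mulf_eq0 !(negPf (n0 _ _)) /= => Ed.
case: k b0 X0 X1 E1 E0 Ed => [|l] b0 _ _ _ _ Ed.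
  split=> //; apply/eqP; move: Ed.
  rewrite addr0 mulf_eq0 (negPf Db0) pnatr_eq0 !orbF => /eqP e.
  by apply/eqP; apply: (eq_sub_mul (1 / 2%:R) e); field.
exfalso.
(* From degree 3 on, column 3 is obtained both directly from column 0 and through column 2, which
   gives a second equation for [Db]. *)
have := coef_LY l 2 0 Hh; have := coef_LY l 0 2 Hh; have := coef_LY l.+1 1 0 Hh.
rewrite !add0n !addn0 ?addn1 ?addn2 ?addn3 ?addSn ?addn1 ?addn2 ?addn3.
move=> /eqP; rewrite -subr_eq0; set Y3 := (X in X == 0) => /eqP F3.
move=> /eqP; rewrite -subr_eq0; set Y2 := (X in X == 0) => /eqP F2.
move=> /eqP; rewrite -subr_eq0; set Y1 := (X in X == 0) => /eqP F1.
have : (l%:R + 3%:R) * (l%:R + 2%:R) * (l%:R + 1) * ((l%:R + 2%:R * Db)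
   * (4%:R * l%:R + 4%:R + 12%:R * Db) + 3%:R * l%:R + 12%:R * Db)
   * h@_(mon2 l.+3 0) = 0.
  transitivity (24%:R * (2%:R * ((l%:R + 1) * (l%:R / 2%:R + Db)) * Y3 + Y2
    + 3%:R * Y1)); last first.
    by rewrite F1 F2 F3; ring.
  rewrite /Y1 /Y2 /Y3; expand_bin l; move=> x; by field.
rewrite -[l%:R + 1]/(l%:R + 1%:R); move/eqP.
rewrite mulf_eq0 (negPf b0) orbF mulf_eq0 !mulf_eq0 !(negPf (n0 _ _)) /= => /eqP e.
(* Either root of the first equation, put into the second, leaves ±(l + 4) = 0. *)
have l4 : l%:R + 4%:R == 0 :> C.
  case/orP: Ed; rewrite -[l.+1%:R]natr1 => /eqP e'; apply/eqP.
    by apply: (eq_sub_mul 1 e); rewrite (_ : Db = - (l%:R + 2%:R) / 2%:R); [field |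
      apply: (eq_sub_mul (1 / 2%:R) e'); field].
  by apply: (eq_sub_mul (-1) e); rewrite (_ : Db = - (l%:R + 1) / 2%:R); [field |
      apply: (eq_sub_mul (1 / 2%:R) e'); field].
by rewrite (negPf (n0 _ _)) in l4.
Qed.

Lemma mpolyC_1 k : (1 : C)%:MP = 1 :> {mpoly C[k]}.
Proof. exact: mpolyC1. Qed.
#[local] Hint Rewrite mpolyC_1 : scal const.
#[local] Hint Rewrite mpolyCD mpolyCN mpolyCM mpolyC_nat : const.
#[local] Hint Rewrite mcoeff_add mcoeff_opp mcoeff_scale mcoeff_mon2 : coefm.

(** * The listed cocycles *)

(** Normalised and of nonzero determinant: such an F is no coboundary, and by [LL_disc0] every
    normalised cocycle of the same weight is a multiple of it modulo coboundaries. *)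
Definition LL_basic D Db m F : Prop :=
  [/\ D - Db = m.+1%:R, LL_cocycle 0 D 0 Db F, forall k, F@_(mon2 k 1) = 0,
      F@_(mon2 0 0) = 0 & disc Db m F != 0].

Ltac check_cocycle :=
  rewrite /LL_cocycle mpolyC0; autorewrite with comp; scale_to_mul;
  autorewrite with const; gen_atoms.

Ltac check_coef :=
  autorewrite with coefm; rewrite /= ?andbF /=; by ring.

Ltac eval_disc := rewrite /disc; autorewrite with coefm;
  rewrite /= /t2 /t3; autorewrite with bin.

Lemma LL_basic2 D Db : D - Db = 2%:R ->
  LL_basic D Db 1 (L2 ^+ 2 * (2%:R *: D2 + L2)).
Proof.
move=> /(canRL (subrK _)) eD.
(* Exponents 0 and 1 are kept explicit so that [mcoeff_mon2] applies to each monomial. *)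
have -> : L2 ^+ 2 * (2%:R *: D2 + L2) =
    2%:R *: (D2 ^+ 1 * L2 ^+ 2) + D2 ^+ 0 * L2 ^+ 3 by mpoly_ring.
rewrite eD; split.
- by rewrite addrK.
- by check_cocycle; ring.
- by move=> k; check_coef.
- by check_coef.
eval_disc; rewrite [X in X != 0](_ : _ = - 1); last by field.
by rewrite oppr_eq0 oner_eq0.
Qed.

Lemma LL_basic3 D Db : D - Db = 3%:R ->
  LL_basic D Db 2 (D2 * L2 ^+ 2 * (D2 + L2)).
Proof.
move=> /(canRL (subrK _)) eD.
have -> : D2 * L2 ^+ 2 * (D2 + L2) =
    D2 ^+ 2 * L2 ^+ 2 + D2 ^+ 1 * L2 ^+ 3 by mpoly_ring.
rewrite eD; split.
- by rewrite addrK.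
- by check_cocycle; ring.
- by move=> k; check_coef.
- by check_coef.
eval_disc; rewrite [X in X != 0](_ : _ = - 2%:R); last by field.
by rewrite oppr_eq0 pnatr_eq0.
Qed.

Lemma LL_basic4 D Db : D - Db = 4%:R ->
  LL_basic D Db 3 (L2 ^+ 2 * (4%:R *: D2 ^+ 3 + 6%:R *: (D2 ^+ 2 * L2)
    - D2 * L2 ^+ 2 + Db *: L2 ^+ 3)).
Proof.
move=> /(canRL (subrK _)) eD.
have -> : L2 ^+ 2 * (4%:R *: D2 ^+ 3 + 6%:R *: (D2 ^+ 2 * L2) - D2 * L2 ^+ 2
      + Db *: L2 ^+ 3) =
    4%:R *: (D2 ^+ 3 * L2 ^+ 2) + 6%:R *: (D2 ^+ 2 * L2 ^+ 3)
    - D2 ^+ 1 * L2 ^+ 4 + Db *: (D2 ^+ 0 * L2 ^+ 5) by mpoly_ring.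
rewrite eD; split.
- by rewrite addrK.
- by check_cocycle; ring.
- by move=> k; check_coef.
- by check_coef.
eval_disc; rewrite [X in X != 0](_ : _ = - 20%:R); last by field.
by rewrite oppr_eq0 pnatr_eq0.
Qed.

Lemma LL_basic5 :
  LL_basic 1 (- 4%:R) 4 (D2 ^+ 4 * L2 ^+ 2 - 10%:R *: (D2 ^+ 2 * L2 ^+ 4)
           - 17%:R *: (D2 * L2 ^+ 5) - 8%:R *: L2 ^+ 6).
Proof.
have -> : D2 ^+ 4 * L2 ^+ 2 - 10%:R *: (D2 ^+ 2 * L2 ^+ 4)
      - 17%:R *: (D2 * L2 ^+ 5) - 8%:R *: L2 ^+ 6 =
    D2 ^+ 4 * L2 ^+ 2 - 10%:R *: (D2 ^+ 2 * L2 ^+ 4)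
      - 17%:R *: (D2 ^+ 1 * L2 ^+ 5) - 8%:R *: (D2 ^+ 0 * L2 ^+ 6) by mpoly_ring.
split.
- by ring.
- by check_cocycle; ring.
- by move=> k; check_coef.
- by check_coef.
eval_disc; rewrite [X in X != 0](_ : _ = - 30%:R); last by field.
by rewrite oppr_eq0 pnatr_eq0.
Qed.

Lemma LL_basic6 D Db : D - Db = 6%:R -> (2%:R * Db + 5%:R) ^+ 2 = 19%:R ->
  LL_basic D Db 5 (D2 ^+ 4 * L2 ^+ 3 - (2%:R * Db + 3%:R) *: (D2 ^+ 3 * L2 ^+ 4)
           - (3%:R * Db) *: (D2 ^+ 2 * L2 ^+ 5)
           - (3%:R * Db + 1) *: (D2 * L2 ^+ 6)
           - (Db + 9%:R / 28%:R) *: L2 ^+ 7).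
Proof.
move=> /(canRL (subrK _)) eD eDb.
have eR : (2%:R * Db%:MP + 5%:R) ^+ 2 = 19%:R :> {mpoly C[3]}.
  have := congr1 (@mpolyC 3 C) eDb.
  by rewrite rmorphXn /= mpolyCD mpolyCM !mpolyC_nat.
set F := (X in LL_basic _ _ _ X).
(* G is 28 F, without the denominator of 9/28. *)
pose G := 28%:R *: (D2 ^+ 4 * L2 ^+ 3) - (56%:R * Db + 84%:R) *: (D2 ^+ 3 * L2 ^+ 4)
  - (84%:R * Db) *: (D2 ^+ 2 * L2 ^+ 5) - (84%:R * Db + 28%:R) *: (D2 ^+ 1 * L2 ^+ 6)
  - (28%:R * Db + 9%:R) *: (D2 ^+ 0 * L2 ^+ 7).
have e28 : 28%:R * 28%:R^-1%:MP = 1 :> {mpoly C[2]}.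
  by rewrite -mpolyC_nat -mpolyCM divff ?mpolyC1 // pnatr_eq0.
have -> : F = 28%:R^-1 *: G.
  (* F without its 9/28 term. The image of 1/28 is an atom for [ring], so 28 * (1/28) = 1 is
     supplied with this cofactor. *)
  pose cof := D2 ^+ 4 * L2 ^+ 3 - (2%:R * Db + 3%:R) *: (D2 ^+ 3 * L2 ^+ 4)
    - (3%:R * Db) *: (D2 ^+ 2 * L2 ^+ 5) - (3%:R * Db + 1) *: (D2 * L2 ^+ 6)
    - Db *: L2 ^+ 7.
  refine (eq_sub_mul (- cof) e28 _); rewrite /F /G /cof.
  by scale_to_mul; autorewrite with const; gen_atoms; ring.
rewrite /G eD; split.
- by rewrite addrK.
- apply: LL_cocycleZ; rewrite /LL_cocycle mpolyC0; autorewrite with comp.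
  (* [cof] is the quotient of the defect of the cocycle equation by
     [(2 Db + 5)^2 - 19]. *)
  pose cof := 21%:R * (Lv ^+ 5 * Mv ^+ 3 + Lv ^+ 6 * Mv ^+ 2
      - Lv ^+ 2 * Mv ^+ 6 - Lv ^+ 3 * Mv ^+ 5)
    + 42%:R * (Dv * (Lv ^+ 4 * Mv ^+ 3 + Lv ^+ 5 * Mv ^+ 2
      - Lv ^+ 2 * Mv ^+ 5 - Lv ^+ 3 * Mv ^+ 4)
      + Dv ^+ 2 * (Lv ^+ 4 * Mv ^+ 2 - Lv ^+ 2 * Mv ^+ 4)).
  refine (eq_sub_mul cof eR _); rewrite /cof.
  by scale_to_mul; autorewrite with const; gen_atoms; ring.
- by move=> k; check_coef.
- by check_coef.
eval_disc; rewrite [X in X != 0](_ : _ = - 3%:R * (2%:R * Db + 5%:R)); last by field.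
rewrite mulf_eq0 oppr_eq0 pnatr_eq0 /=; apply/eqP => e.
by move/eqP: eDb; rewrite e expr0n eq_sym pnatr_eq0.
Qed.

(** * Classification *)

Definition LL_list D Db F : Prop :=
  (D - Db = 2%:R /\ F = L2 ^+ 2 * (2%:R *: D2 + L2))
   \/ (D - Db = 3%:R /\ F = D2 * L2 ^+ 2 * (D2 + L2))
   \/ (D - Db = 4%:R /\
       F = L2 ^+ 2 * (4%:R *: D2 ^+ 3 + 6%:R *: (D2 ^+ 2 * L2) - D2 * L2 ^+ 2
                     + Db *: L2 ^+ 3))
   \/ (D = 1 /\ Db = - 4%:R /\
       F = D2 ^+ 4 * L2 ^+ 2 - 10%:R *: (D2 ^+ 2 * L2 ^+ 4)
           - 17%:R *: (D2 * L2 ^+ 5) - 8%:R *: L2 ^+ 6)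
   \/ (exists s : C, (s = 1 \/ s = -1) /\
       D = 7%:R / 2%:R + s * sqrtC 19%:R / 2%:R /\
       Db = - (5%:R / 2%:R) + s * sqrtC 19%:R / 2%:R /\
       F = D2 ^+ 4 * L2 ^+ 3 - (2%:R * Db + 3%:R) *: (D2 ^+ 3 * L2 ^+ 4)
           - (3%:R * Db) *: (D2 ^+ 2 * L2 ^+ 5)
           - (3%:R * Db + 1) *: (D2 * L2 ^+ 6)
           - (Db + 9%:R / 28%:R) *: L2 ^+ 7).

Definition LY_list D Db h : Prop :=
  (D - Db = - (1 / 2%:R) /\ exists a0 : C, a0 != 0 /\ h = a0%:MP)
  \/ (D - Db = 1 / 2%:R /\ exists a0 : C, a0 != 0 /\ h = a0 *: (D2 + (2%:R * Db) *: L2))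
  \/ (D = 1 /\ Db = - (1 / 2%:R) /\ exists a0 : C, a0 != 0 /\ h = a0 *: (D2 ^+ 2 - L2 ^+ 2)).

Lemma listed0P D Db f g h : listed 0 D Db f g h <->
  (g = 0 /\ h = 0 /\ ((D = Db /\ exists c0 c1 : C, (c0, c1) != (0, 0) /\
     f = c0%:MP + c1%:MP * L2) \/ LL_list D Db f)) \/
  (f = 0 /\ g = 0 /\ LY_list D Db h).
Proof.
rewrite /listed mpolyC0 addr0 /LL_list /LY_list; tauto.
Qed.

Lemma LL_list_basic D Db F : LL_list D Db F -> exists m, LL_basic D Db m F.
Proof.
case=> [[e ->]|[[e ->]|[[e ->]|[[-> [-> ->]]|[s [es [eD [eDb ->]]]]]]]].
- by exists 1%N; apply: LL_basic2.
- by exists 2%N; apply: LL_basic3.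
- by exists 3%N; apply: LL_basic4.
- by exists 4%N; apply: LL_basic5.
exists 5%N; apply: LL_basic6; first by rewrite eD eDb; field.
have s2 : s ^+ 2 = 1 by case: es => ->; rewrite ?expr1n ?sqrrN ?expr1n.
have q := sqrtCK (19%:R : C); rewrite eDb; set t := sqrtC 19%:R in q *.
by transitivity (s ^+ 2 * t ^+ 2); [field | rewrite s2 mul1r].
Qed.

Lemma LL_list_exists D Db m f : Db != 0 -> D - Db = m.+1%:R ->
  LL_cocycle 0 D 0 Db f -> disc Db m f != 0 ->
  exists F, LL_list D Db F /\ LL_basic D Db m F.
Proof.
move=> Db0 Dm Hf nz; suff [F LF] : exists F, LL_list D Db F.
  exists F; split=> //; have [m' B] := LL_list_basic LF.
  suff -> : m = m' by [].
  by case: B => /eqP; rewrite Dm eqr_nat eqSS => /eqP.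
case: (LL_disc_neq0 Db0 Hf nz) => [|[em eDb]|[em eDb]].
- case: m Dm {nz} => [|[|[|[|m]]]] // Dm _; eexists.
  + by left.
  + by right; left.
  + by right; right; left.
- eexists; right; right; right; left; split; last by split.
  by apply: (eq_sub_eq Dm); rewrite em eDb; ring.
have eD : D = Db + 6%:R by apply: (eq_sub_eq Dm); rewrite em; ring.
(* The sign of the square root becomes the witness s. *)
have : (2%:R * Db + 5%:R == sqrtC 19%:R) || (2%:R * Db + 5%:R == - sqrtC 19%:R).
  by rewrite -eqf_sqr sqrtCK eDb.
move=> e; eexists; right; right; right; right; case/orP: e => /eqP e.
  exists 1; split; first by left.
  rewrite -e eD; split; [by field | split; [by field | by []]].
exists (-1); split; first by right.
rewrite mulN1r -e eD; split; [by field | split; [by field | by []]].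
Qed.

(** The integer n is recorded because integrality of Δ - Δbar later excludes a simultaneous nonzero
    h. *)
Lemma LL_classify D Db f : Db != 0 -> LL_cocycle 0 D 0 Db f ->
  (exists r, f + coboundary 0 D 0 Db r = 0) \/
  exists (F : {mpoly C[2]}) (c : C) r n, [/\ D - Db = n%:R, c != 0,
   f + coboundary 0 D 0 Db r = c *: F &
   (D = Db /\ exists c0 c1 : C, (c0, c1) != (0, 0) /\ F = c0%:MP + c1%:MP * L2)
   \/ LL_list D Db F].
Proof.
move=> Db0 Hf; have [r [f1 [ef1 Hr]]] := LL_normalize Db0 Hf.
have H1 : LL_cocycle 0 D 0 Db f1.
  by rewrite ef1; apply: (LL_cocycleD Hf (LL_cocycle_coboundary 0 D 0 Db r)).
have [eD | neD] := eqVneq D Db.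
  set c0 := f1@_(mon2 0 0); set c1 := f1@_(mon2 0 1).
  pose F := c0%:MP + c1%:MP * L2.
  have eF : F = c0 *: (D2 ^+ 0 * L2 ^+ 0) + c1 *: (D2 ^+ 0 * L2 ^+ 1).
    by rewrite /F; mpoly_ring.
  have HF : LL_cocycle 0 D 0 Db (- 1 *: F).
    apply: LL_cocycleZ; rewrite eD /F; check_cocycle; ring.
  have e1 : f1 = F.
    apply: subr0_eq; rewrite -scaleN1r; apply: (LL_eq0 Db0).
    - exact: (LL_cocycleD H1 HF).
    - move=> k; rewrite eF; autorewrite with coefm.
      case: k => [|k]; first by rewrite -/c1 /=; ring.
      by rewrite Hr //=; ring.
    - by rewrite eF; autorewrite with coefm; rewrite -/c0 /=; ring.
    - by move=> k; rewrite eD subrr => /esym/eqP; rewrite pnatr_eq0.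
    - by move=> k; rewrite eD subrr => /esym/eqP; rewrite pnatr_eq0.
  have [ec | nec] := eqVneq (c0, c1) (0, 0).
    left; exists r; rewrite -ef1 e1 /F; case: ec => -> ->.
    by rewrite mpolyC0 mul0r addr0.
  right; exists F, 1, r, 0%N; split.
  - by rewrite eD subrr.
  - exact: oner_neq0.
  - by rewrite scale1r -ef1.
  - by left; split=> //; exists c0, c1.
have N1 k : f1@_(mon2 k 1) = 0 by apply: Hr; rewrite neD implybT.
have N0 : f1@_(mon2 0 0) = 0.
  by have /eqP := coef_00 H1; rewrite mulf_eq0 subr_eq0 (negPf neD) => /eqP.
have [f10 | nz1] := eqVneq f1 0; first by left; exists r; rewrite -ef1.
have [m Dm] := LL_weight Db0 H1 N0 N1 nz1.
have cobD s : coboundary 0 D 0 Db (r + s) =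
    coboundary 0 D 0 Db r + coboundary 0 D 0 Db s.
  have eD k (x : {mpoly C[k]}) : ev1 (r + s) x = ev1 r x + ev1 s x by exact: compD.
  by rewrite /coboundary !eD; mpoly_ring.
have [d0 | nd] := eqVneq (disc Db m f1) 0.
  have [s Hs] := LL_disc0 Db0 Dm H1 N1 N0 d0.
  by left; exists (r + s); rewrite cobD addrA -ef1.
have [F [LF [_ HF F1 F0 dF]]] := LL_list_exists Db0 Dm H1 nd.
(* Chosen so that f1 - c F has determinant 0 and is therefore a coboundary. *)
pose c := disc Db m f1 / disc Db m F.
have Hg : LL_cocycle 0 D 0 Db (f1 + (- c) *: F).
  by apply: LL_cocycleD => //; apply: LL_cocycleZ.
have [s Hs] : exists s, f1 + (- c) *: F + coboundary 0 D 0 Db s = 0.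
  apply: (LL_disc0 Db0 Dm Hg).
  - by move=> k; rewrite mcoeff_add mcoeff_scale N1 F1 mulr0 addr0.
  - by rewrite mcoeff_add mcoeff_scale N0 F0 mulr0 addr0.
  - by rewrite discD discZ /c mulNr mulfVK // subrr.
right; exists F, c, (r + s), m.+1; split.
- exact: Dm.
- by rewrite /c mulf_neq0 // invr_neq0.
- rewrite cobD addrA -ef1; move: (coboundary 0 D 0 Db s) Hs => t Hs.
  by apply: subr0_eq; rewrite -Hs scaleNr addrAC.
- by right.
Qed.

Lemma LY_form0 (c : C) : c%:MP = c *: (D2 ^+ 0 * L2 ^+ 0) :> {mpoly C[2]}.
Proof. by mpoly_ring. Qed.
Lemma LY_form1 c Db : c *: (D2 + (2%:R * Db) *: L2) =
  c *: (D2 ^+ 1 * L2 ^+ 0) + (c * (2%:R * Db)) *: (D2 ^+ 0 * L2 ^+ 1).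
Proof. by scale_to_mul; autorewrite with const; gen_atoms; ring. Qed.
Lemma LY_form2 c : c *: (D2 ^+ 2 - L2 ^+ 2) =
  c *: (D2 ^+ 2 * L2 ^+ 0) - c *: (D2 ^+ 0 * L2 ^+ 2).
Proof. by mpoly_ring. Qed.

Lemma LY_list_cocycle D Db h : LY_list D Db h ->
  LY_cocycle 0 D 0 Db h /\ exists n, h@_(mon2 n 0) != 0.
Proof.
(* The image of 1/2 is an atom for [ring]; this relation enters below with explicit cofactors. *)
have half2 : 2%:R * (1 / 2%:R : C)%:MP = 1 :> {mpoly C[3]}.
  rewrite -mpolyC_nat -mpolyCM mulrC mulfVK ?mpolyC_1 //.
  by rewrite pnatr_eq0.
case=> [[e [a0 [nz ->]]]|[[e [a0 [nz ->]]]|[-> [-> [a0 [nz ->]]]]]].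
- split; last by exists 0%N; rewrite LY_form0; autorewrite with coefm; rewrite mulr1.
  have -> : D = Db - 1 / 2%:R by apply: (eq_sub_eq e); ring.
  rewrite /LY_cocycle mpolyC0; autorewrite with comp.
  apply: (eq_sub_mul 0 half2).
  scale_to_mul; autorewrite with const; gen_atoms; ring.
- split.
    have -> : D = Db + 1 / 2%:R by apply: (eq_sub_eq e); ring.
    rewrite /LY_cocycle mpolyC0; autorewrite with comp.
    refine (eq_sub_mul (- (a0%:MP * (Dv * Lv
      + Db%:MP * Lv ^+ 2 + 2%:R * Db%:MP * Lv * Mv))) half2 _).
    by scale_to_mul; autorewrite with const; gen_atoms; ring.
  exists 1%N; rewrite LY_form1; autorewrite with coefm.
  by rewrite /= mulr1 mulr0 addr0.
- split.
    rewrite /LY_cocycle mpolyC0; autorewrite with comp.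
    refine (eq_sub_mul (- (a0%:MP * (Dv ^+ 2 * Lv
      + Dv * Lv ^+ 2 - Lv ^+ 2 * Mv - Lv * Mv ^+ 2))) half2 _).
    by scale_to_mul; autorewrite with const; gen_atoms; ring.
  exists 2%N; rewrite LY_form2; autorewrite with coefm.
  by rewrite /= mulr1 mulr0 subr0.
Qed.

Lemma LY_cocycleD D Db h h' : LY_cocycle 0 D 0 Db h -> LY_cocycle 0 D 0 Db h' ->
  LY_cocycle 0 D 0 Db (h + h').
Proof.
rewrite /LY_cocycle => H H'; autorewrite with comp; rewrite [RHS]mulrDr -H -H'.
by mpoly_ring.
Qed.

Lemma LY_cocycleZ D Db c h : LY_cocycle 0 D 0 Db h -> LY_cocycle 0 D 0 Db (c *: h).
Proof.
rewrite /LY_cocycle => H; autorewrite with comp.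
by refine (eq_sub_mul (c%:MP : {mpoly C[3]}) H _); mpoly_ring.
Qed.

Lemma LY_unique D Db h h' : LY_cocycle 0 D 0 Db h -> LY_cocycle 0 D 0 Db h' ->
  (forall k, h@_(mon2 k 0) = h'@_(mon2 k 0)) -> h = h'.
Proof.
move=> H H' e; apply: subr0_eq; rewrite -scaleN1r; apply: (@LY_eq0 D Db).
  exact: (LY_cocycleD H (LY_cocycleZ (-1) H')).
by move=> k; rewrite mcoeff_add mcoeff_scale e mulN1r subrr.
Qed.

Lemma LY_classify D Db h : Db != 0 -> LY_cocycle 0 D 0 Db h -> h != 0 ->
  LY_list D Db h.
Proof.
move=> Db0 Hh h0; have [n [En nz U]] := LY_weight Hh h0.
set a0 := h@_(mon2 n 0) in nz.
suff [h' L e] : exists2 h', LY_list D Db h' & forall k, h@_(mon2 k 0) = h'@_(mon2 k 0).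
  by have [H' _] := LY_list_cocycle L; rewrite (LY_unique Hh H' e).
case: (LY_constraint Db0 Hh nz) => [en|en|[en eDb]].
- exists a0%:MP; first by left; split; [apply: (eq_sub_eq En); rewrite en; ring | exists a0].
  move=> k; rewrite LY_form0; autorewrite with coefm.
  have [-> | ne] := eqVneq k 0%N; first by rewrite /a0 en /=; ring.
  by rewrite U ?en // 1?[0%N == k]eq_sym ?(negPf ne) /= ?andbF /=; ring.
- exists (a0 *: (D2 + (2%:R * Db) *: L2)).
    by right; left; split; [apply: (eq_sub_eq En); rewrite en; field | exists a0].
  move=> k; rewrite LY_form1; autorewrite with coefm.
  have [-> | ne] := eqVneq k 1%N; first by rewrite /a0 en /=; ring.
  by rewrite U ?en // 1?[1%N == k]eq_sym ?(negPf ne) /= ?andbF /=; ring.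
- exists (a0 *: (D2 ^+ 2 - L2 ^+ 2)).
    right; right; split; last by split=> //; exists a0.
    by apply: (eq_sub_eq En); rewrite en eDb; field.
  move=> k; rewrite LY_form2; autorewrite with coefm.
  have [-> | ne] := eqVneq k 2%N; first by rewrite /a0 en /=; ring.
  by rewrite U ?en // 1?[2%N == k]eq_sym ?(negPf ne) /= ?andbF /=; ring.
Qed.

(** * Extensions with α = αbar = 0 *)

Lemma classify0 D Db f g h : Db != 0 -> is_conf_module 0 D 0 Db f g h ->
  ext_trivial 0 D 0 Db f g h \/
  exists f0 g0 h0 c, listed 0 D Db f0 g0 h0 /\ c != 0 /\
    ext_equiv 0 D 0 Db f g h (c *: f0) (c *: g0) (c *: h0).
Proof.
move=> Db0 /conf_moduleP [Hf -> Hh].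
have [-> | h0] := eqVneq h 0.
  case: (LL_classify Db0 Hf) => [[r Hr]|[F [c [r [n [_ c0 Hr L]]]]]].
    by left; apply/ext_equivP; exists r; split; rewrite ?Hr.
  right; exists F, 0, 0, c; split; first by apply/listed0P; left.
  by split=> //; apply/ext_equivP; exists r; rewrite !scaler0 Hr.
right; have LH := LY_classify Db0 Hh h0.
case: (LL_classify Db0 Hf) => [[r Hr]|[F [c [r [n [En _ _ _]]]]]].
  exists 0, 0, h, 1; split; first by apply/listed0P; right.
  split; first exact: oner_neq0.
  by apply/ext_equivP; exists r; rewrite !scaler0 scale1r Hr.
(* A nontrivial f makes Δ - Δbar an integer, a nonzero h makes it a half-integer: 2n + 1 = 2m is
   impossible. *)
have [m [Em _ _]] := LY_weight Hh h0.
have /eqP : (2 * n + 1)%:R = (2 * m)%:R :> C.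
  by rewrite natrD !natrM -Em En; field.
by rewrite eqr_nat => /eqP; lia.
Qed.

(** Nontriviality: coboundaries do not touch h; for Δ = Δbar they have no constant term and no term
    in λ alone to the first power; in the other cases [disc] detects f. *)
Lemma listed0_module D Db f g h c : Db != 0 -> listed 0 D Db f g h -> c != 0 ->
  is_conf_module 0 D 0 Db (c *: f) (c *: g) (c *: h) /\
  ~ ext_trivial 0 D 0 Db (c *: f) (c *: g) (c *: h).
Proof.
move=> Db0 /listed0P [[-> [-> L]]|[-> [-> L]]] c0; last first.
  have [Hh [n nz]] := LY_list_cocycle L; split.
    apply/conf_moduleP; split; rewrite ?scaler0 //; last exact: LY_cocycleZ.
    by rewrite /LL_cocycle; autorewrite with comp; ring.
  move/ext_equivP => [r [_ _ /(congr1 (fun P => P@_(mon2 n 0)))]].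
  rewrite mcoeff0 mcoeff_scale => /esym/eqP; rewrite mulf_eq0 (negPf c0).
  by rewrite (negPf nz).
have LY0 : LY_cocycle 0 D 0 Db (c *: 0).
  by rewrite scaler0 /LY_cocycle; autorewrite with comp; rewrite !mulr0 subrr.
case: L => [[eD [c1 [c2 [nz ->]]]]|L].
  have -> : c1%:MP + c2%:MP * L2 =
      c1 *: (D2 ^+ 0 * L2 ^+ 0) + c2 *: (D2 ^+ 0 * L2 ^+ 1) by mpoly_ring.
  split.
    apply/conf_moduleP; split; rewrite ?scaler0 //; last by rewrite -(scaler0 _ c).
    by rewrite eD; apply: LL_cocycleZ; check_cocycle; ring.
  move/ext_equivP => [r [E _ _]]; case/eqP: nz; congr pair.
    have /esym/eqP := congr1 (fun P => P@_(mon2 0 0)) E.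
    rewrite mcoeff0 mcoeff_add coef_coboundary0; autorewrite with coefm.
    by rewrite /= mulr1 mulr0 !addr0 mulf_eq0 (negPf c0) => /eqP.
  have /esym/eqP := congr1 (fun P => P@_(mon2 0 1)) E.
  rewrite mcoeff0 mcoeff_add coef_coboundary1 eD; autorewrite with coefm.
  by rewrite /= subrr subr0 mul0r mulr1 mulr0 addr0 add0r mulf_eq0 (negPf c0) => /eqP.
have [m [_ HF _ _ dF]] := LL_list_basic L; split.
  apply/conf_moduleP; split; rewrite ?scaler0 //; last by rewrite -(scaler0 _ c).
  exact: LL_cocycleZ.
move/ext_equivP => [r [/(congr1 (disc Db m)) E _ _]]; move/eqP: E.
rewrite discD disc_cob discZ addr0 (_ : disc Db m 0 = 0); last first.
  by rewrite -(scale0r f) discZ mul0r.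
by rewrite eq_sym mulf_eq0 (negPf c0) (negPf dF).
Qed.

(** * Return to arbitrary α *)

Lemma trZ a c f : tr a (c *: f) = c *: tr a f. Proof. exact: evZ. Qed.
Lemma tr0 a : tr a 0 = 0. Proof. exact: ev0. Qed.

Lemma listed_tr a D Db c f g h : listed a D Db f g h ->
  listed (a + c) D Db (tr c f) (tr c g) (tr c h).
Proof.
have eD : D2 + c%:MP + a%:MP = D2 + (a + c)%:MP.
  by rewrite mpolyCD -addrA [c%:MP + _]addrC.
rewrite /listed /tr.
case=> [[-> [-> L]]|[[e [-> [-> [c0 [nz ->]]]]]|
  [[e [-> [-> [c0 [nz ->]]]]]|[e [e' [-> [-> [c0 [nz ->]]]]]]]]].
- left; split; first exact: ev0; split; first exact: ev0.
  case: L => [[e [c0 [c1 [nz ->]]]]|[[e ->]|[[e ->]|[[e ->]|[[e [e' ->]]|[s [es [e [e' ->]]]]]]]]].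
  + by left; split=> //; exists c0, c1; split=> //; autorewrite with comp.
  + by right; left; split=> //; autorewrite with comp; rewrite eD.
  + by right; right; left; split=> //; autorewrite with comp; rewrite eD.
  + by right; right; right; left; split=> //; autorewrite with comp; rewrite eD.
  + by right; right; right; right; left; do 2![split=> //]; autorewrite with comp; rewrite eD.
  right; right; right; right; right; exists s; do 3![split=> //].
  by autorewrite with comp; rewrite eD.
- by right; left; do 3![split; first by rewrite ?ev0]; exists c0; split=> //; autorewrite with comp.
- right; right; left; do 3![split; first by rewrite ?ev0]; exists c0; split=> //.
  by autorewrite with comp; rewrite eD.
right; right; right; split=> //; do 3![split; first by rewrite ?ev0].
by exists c0; split=> //; autorewrite with comp; rewrite eD.
Qed.

Lemma listed_shift a D Db f g h : listed a D Db f g h ->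
  D - Db \in allowed_shifts C.
Proof.
have nthP i : (i < 9)%N -> nth 0 (allowed_shifts C) i \in allowed_shifts C.
  by move=> lt_i; apply: mem_nth.
case=> [[_ [_ L]]|[[-> _]|[[-> _]|[-> [-> _]]]]].
- case: L => [[-> _]|[[-> _]|[[-> _]|[[-> _]|[[-> [-> _]]|[s [_ [-> [-> _]]]]]]]]].
  + by rewrite subrr; apply: (nthP 0%N).
  + exact: (nthP 1%N).
  + exact: (nthP 2%N).
  + exact: (nthP 3%N).
  + by rewrite (_ : 1 - - 4%:R = 5%:R); [apply: (nthP 4%N) | ring].
  by rewrite (_ : _ - _ = 6%:R); [apply: (nthP 5%N) | field].
- exact: (nthP 7%N).
- exact: (nthP 6%N).
by rewrite (_ : 1 - - (1 / 2%:R) = 3%:R / 2%:R); [apply: (nthP 8%N) | field].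
Qed.

Lemma classify a D abar Db f g h : Db != 0 -> is_conf_module a D abar Db f g h ->
  ext_trivial a D abar Db f g h \/
  a = abar /\ exists f0 g0 h0 c, listed a D Db f0 g0 h0 /\ c != 0 /\
    ext_equiv a D abar Db f g h (c *: f0) (c *: g0) (c *: h0).
Proof.
move=> Db0; have [<- {abar} | ne] := eqVneq a abar => H; last first.
  left; case/conf_moduleP: H => Hf -> Hh; apply/ext_equivP.
  have [r Hr] := LL_cocycle_neq ne Hf; exists r; split=> //.
  exact/esym/(LY_cocycle_neq ne Hh).
have trKa f' : tr a (tr (- a) f') = f' by rewrite -{1}(opprK a) trK.
have := is_conf_module_tr (- a) H; rewrite subrr => /(classify0 Db0).
have back f1 g1 h1 : ext_equiv 0 D 0 Db (tr (- a) f) (tr (- a) g) (tr (- a) h) f1 g1 h1 ->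
    ext_equiv a D a Db f g h (tr a f1) (tr a g1) (tr a h1).
  by move/(ext_equiv_tr a); rewrite add0r !trKa.
case=> [/back T | [f0 [g0 [h0 [c [L [c0 /back E]]]]]]].
  by left; move: T; rewrite tr0.
right; split=> //; exists (tr a f0), (tr a g0), (tr a h0), c; rewrite -!trZ.
by split; [have := listed_tr a L; rewrite add0r | split].
Qed.

Lemma listed_module a D Db f g h c : Db != 0 -> listed a D Db f g h -> c != 0 ->
  is_conf_module a D a Db (c *: f) (c *: g) (c *: h) /\
  ~ ext_trivial a D a Db (c *: f) (c *: g) (c *: h).
Proof.
move=> Db0 /(listed_tr (- a)); rewrite subrr => L c0.
have trKa f' : tr a (tr (- a) f') = f' by rewrite -{1}(opprK a) trK.
have [H N] := listed0_module Db0 L c0; split.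
  by have := is_conf_module_tr a H; rewrite !trZ !trKa add0r.
by move=> /(ext_equiv_tr (- a)); rewrite subrr !trZ tr0.
Qed.
End Extensions.

Theorem theorem3p7 (C : numClosedFieldType) (a abar D Dbar : C)
  (hD : D != 0) (hDbar : Dbar != 0) :
  (* nontrivial extensions exist only if α = αbar and Δ - Δbar ∈ {...} *)
  (forall f g h : {mpoly C[2]},
     is_conf_module a D abar Dbar f g h ->
     ~ ext_trivial a D abar Dbar f g h ->
     a = abar /\ D - Dbar \in allowed_shifts C)
  (* every nontrivial extension is equivalent to a nonzero multiple of a listed one *)
  /\ (forall f g h : {mpoly C[2]},
     is_conf_module a D abar Dbar f g h ->
     ~ ext_trivial a D abar Dbar f g h ->
     exists (f0 g0 h0 : {mpoly C[2]}) (c : C),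
       listed a D Dbar f0 g0 h0 /\ c != 0 /\
       ext_equiv a D abar Dbar f g h (c *: f0) (c *: g0) (c *: h0))
  (* nonzero multiples of listed triples give nontrivial extensions (α = αbar) *)
  /\ (a = abar ->
      forall (f0 g0 h0 : {mpoly C[2]}) (c : C),
       listed a D Dbar f0 g0 h0 -> c != 0 ->
       is_conf_module a D abar Dbar (c *: f0) (c *: g0) (c *: h0) /\
       ~ ext_trivial a D abar Dbar (c *: f0) (c *: g0) (c *: h0)).
Proof.
split; [|split].
- move=> f g h /(classify hDbar) [T /(_ T) // | [-> [f0 [g0 [h0 [c [L _]]]]]] _].
  by split=> //; apply: listed_shift L.
- by move=> f g h /(classify hDbar) [T /(_ T) // | [_ E] _].
by move=> <- f0 g0 h0 c L c0; apply: listed_module.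
Qed.
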